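(* Let $G$ be an abelian group that is either mixed or torsion-free. Then every subgroup of $G$ is an essential subgroup of some direct summand of $G$ if, and only if, $G = D \oplus R$, where $D = T(D) \oplus D_0$ is a divisible group (with $T(D)$ its torsion subgroup and $D_0$ torsion-free) and $R$ is a homogeneous completely (fully) decomposable torsion-free group of finite rank. In particular, every such group $G$ is semi-generalized Bassian.
   Context: All groups are additively written abelian groups; a mixed group contains both non-zero elements of finite order and elements of infinite order; $T(A)$ denotes the torsion subgroup of $A$. A subgroup $H$ of a group $A$ is essential in $A$ if $H \cap S \neq \{0\}$ for every non-zero subgroup $S$ of $A$. A torsion-free group is fully decomposable if it is a direct sum of rank-one groups, and homogeneous if all its non-zero elements have the same type. A group $G$ is semi-generalized Bassian if, for every subgroup $H \le G$, the existence of an injective homomorphism $G \to G/H$ implies that $H$ is an essential subgroup of some direct summand of $G$. *)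

(* Defs.v *)
From mathcomp Require Import all_boot all_algebra.
Set Implicit Arguments.
Unset Strict Implicit.
Unset Printing Implicit Defensive.
Import GRing.Theory Num.Theory.
Local Open Scope ring_scope.

Section AbGroups.
Variable V : zmodType.

Definition subgroup (H : V -> Prop) : Prop :=
  H 0 /\ (forall x y, H x -> H y -> H (x - y)).

Definition subsetP (A B : V -> Prop) : Prop := forall x, A x -> B x.

Definition is_torsion (x : V) : Prop := exists n : nat, (0 < n)%N /\ x *+ n = 0.

Definition torsion_part (A : V -> Prop) : V -> Prop := fun x => A x /\ is_torsion x.

Definition torsion_free_on (A : V -> Prop) : Prop :=
  forall x, A x -> is_torsion x -> x = 0.

Definition torsion_free_group : Prop := torsion_free_on (fun _ => True).

Definition mixed_group : Prop :=
  (exists x, x <> 0 /\ is_torsion x) /\ (exists x, ~ is_torsion x).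

Definition direct_sum_of (C A B : V -> Prop) : Prop :=
  subgroup A /\ subgroup B /\
  (forall x, A x -> B x -> x = 0) /\
  (forall x, C x <-> exists a b, A a /\ B b /\ x = a + b).

Definition direct_summand (A : V -> Prop) : Prop :=
  exists B, direct_sum_of (fun _ => True) A B.

Definition essential_in (H A : V -> Prop) : Prop :=
  subgroup H /\ subsetP H A /\
  forall S, subgroup S -> subsetP S A -> (exists x, S x /\ x <> 0) ->
    exists x, S x /\ H x /\ x <> 0.

Definition divisible_on (A : V -> Prop) : Prop :=
  subgroup A /\ forall x n, A x -> (0 < n)%N -> exists y, A y /\ y *+ n = x.

Definition pdiv_in (A : V -> Prop) (p k : nat) (x : V) : Prop :=
  exists y, A y /\ y *+ (p ^ k) = x.

(* x and y (in the torsion-free group A) have the same type: their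
   characteristics (p-heights in A) agree at all but finitely many primes,
   and at every prime the heights are either both infinite or both finite. *)
Definition same_type (A : V -> Prop) (x y : V) : Prop :=
  (forall p, prime p ->
     ((forall k, pdiv_in A p k x) <-> (forall k, pdiv_in A p k y))) /\
  (exists N : nat, forall p, prime p -> (N <= p)%N ->
     forall k, (pdiv_in A p k x <-> pdiv_in A p k y)).

Definition homogeneous_on (A : V -> Prop) : Prop :=
  forall x y, A x -> A y -> x <> 0 -> y <> 0 -> same_type A x y.

Definition rank_one (A : V -> Prop) : Prop :=
  subgroup A /\ torsion_free_on A /\ (exists x, A x /\ x <> 0) /\
  forall x y, A x -> A y ->
    exists m n : int, (m != 0 \/ n != 0) /\ x *~ m = y *~ n.

Definition independent (s : seq V) : Prop :=
  forall c : 'I_(size s) -> int,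
    \sum_(i < size s) s`_i *~ c i = 0 -> forall i, c i = 0.

Definition finite_rank_on (A : V -> Prop) : Prop :=
  exists n : nat, forall s : seq V, (forall x, x \in s -> A x) ->
    independent s -> (size s <= n)%N.

Definition fully_decomposable_on (A : V -> Prop) : Prop :=
  subgroup A /\
  exists (I : Type) (F : I -> V -> Prop),
    (forall i, rank_one (F i)) /\ (forall i, subsetP (F i) A) /\
    (forall x, A x -> exists (n : nat) (idx : 'I_n -> I) (f : 'I_n -> V),
        (forall j, F (idx j) (f j)) /\ x = \sum_(j < n) f j) /\
    (forall (n : nat) (idx : 'I_n -> I) (f : 'I_n -> V),
        (forall j k, idx j = idx k -> j = k) ->
        (forall j, F (idx j) (f j)) -> \sum_(j < n) f j = 0 ->
        forall j, f j = 0).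

(* an injective homomorphism V -> V/H, written via a choice of
   representatives: x |-> f x + H *)
Definition inj_hom_to_quotient (H : V -> Prop) : Prop :=
  exists f : V -> V,
    (forall x y, H (f (x + y) - (f x + f y))) /\
    (forall x, H (f x) -> x = 0).

Definition semi_generalized_Bassian : Prop :=
  forall H, subgroup H -> inj_hom_to_quotient H ->
    exists A, direct_summand A /\ essential_in H A.

End AbGroups.

(* Main.v *)
(* Suppose every subgroup of V is essential in a summand. The torsion subgroup T is then a summand,
   V = T + F, and T is divisible as soon as some z has infinite order: the projection onto a summand
   in which n z + t generates an essential subgroup kills t, so n divides n z + t and hence t. Pure
   subgroups of F are summands, so F = D0 + R with D0 divisible and R reduced. Pure lines split off R,
   which gives complete decomposability once the rank is finite; comparing with the pure line of
   n a + b gives equal types; and an infinite independent sequence would give a pure subgroup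
   generated by the a_i - (i+1) a_(i+1) without complement.

   Conversely let V = D + R. Rescale generators a_i of the rank-one summands of R so that they are
   divisible by the same integers; every unimodular change of the a_i is then again a decomposition
   of R, and the Smith normal form adapts it to any pure subgroup, which is thus a summand. Given H,
   split R = P + Q with P the purification of the image of H in R, take D1 in D maximal disjoint from
   H (it is divisible) and M maximal disjoint from D1 containing H and Q; then M meets D + P in a
   summand of V in which H is essential. *)

Require Import Defs.
From mathcomp Require Import all_boot all_algebra.
From mathcomp Require boolp classical_sets.
Set Implicit Arguments.
Unset Strict Implicit.
Unset Printing Implicit Defensive.
Import GRing.Theory Num.Theory.
Local Open Scope ring_scope.

Local Notation EM := boolp.EM.
Local Notation contrapT := boolp.contrapT.

(** * Subgroups, sums and projections *)

Section Subgroups.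
Variable V : zmodType.
Implicit Types (A B C D H K P Q R : V -> Prop) (x y z : V).

Lemma sgrp0 A : subgroup A -> A 0.
Proof. by case. Qed.

Lemma sgrpB A x y : subgroup A -> A x -> A y -> A (x - y).
Proof. by case=> _; exact. Qed.

Lemma sgrpN A x : subgroup A -> A x -> A (- x).
Proof. by move=> sA Ax; rewrite -sub0r; apply: sgrpB => //; exact: sgrp0. Qed.

Lemma sgrpD A x y : subgroup A -> A x -> A y -> A (x + y).
Proof.
by move=> sA Ax Ay; rewrite -[y]opprK; apply: sgrpB => //; exact: sgrpN.
Qed.

Lemma sgrpMn A x n : subgroup A -> A x -> A (x *+ n).
Proof.
move=> sA Ax; elim: n => [|n IHn]; first by rewrite mulr0n; exact: sgrp0.
by rewrite mulrS; exact: sgrpD.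
Qed.

Lemma sgrpMz A x m : subgroup A -> A x -> A (x *~ m).
Proof.
move=> sA Ax; case: m => n; first exact: sgrpMn.
by rewrite NegzE mulrNz; apply: sgrpN => //; exact: sgrpMn.
Qed.

Lemma sgrp_sum A (I : Type) (r : seq I) (p : pred I) (F : I -> V) :
  subgroup A -> (forall i, p i -> A (F i)) -> A (\sum_(i <- r | p i) F i).
Proof.
move=> sA AF; apply: (big_ind A) => //; first exact: sgrp0.
by move=> *; exact: sgrpD.
Qed.

Lemma sgrpDl A x y : subgroup A -> A x -> A (x + y) -> A y.
Proof. by move=> sA Ax Axy; rewrite -(addKr x y) addrC; exact: sgrpB. Qed.

Lemma sgrpI A B : subgroup A -> subgroup B -> subgroup (fun x => A x /\ B x).
Proof.
move=> sA sB; split; first by split; exact: sgrp0.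
by move=> x y [Ax Bx] [Ay By]; split; exact: sgrpB.
Qed.

Definition sumsg A B x := exists a b, A a /\ B b /\ x = a + b.

Lemma sgrp_sumsg A B : subgroup A -> subgroup B -> subgroup (sumsg A B).
Proof.
move=> sA sB; split.
  by exists 0, 0; rewrite addr0; do !split; exact: sgrp0.
move=> _ _ [a [b [Aa [Bb ->]]]] [a' [b' [Aa' [Bb' ->]]]].
exists (a - a'), (b - b'); rewrite opprD addrACA; do !split => //; exact: sgrpB.
Qed.

Lemma sumsgl A B x : subgroup B -> A x -> sumsg A B x.
Proof. by move=> sB Ax; exists x, 0; rewrite addr0; do !split => //; exact: sgrp0. Qed.

Lemma sumsgr A B x : subgroup A -> B x -> sumsg A B x.
Proof. by move=> sA Bx; exists 0, x; rewrite add0r; do !split => //; exact: sgrp0. Qed.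

Definition mults x y := exists m : int, y = x *~ m.

Lemma sgrp_mults x : subgroup (mults x).
Proof.
split; first by exists 0; rewrite mulr0z.
by move=> _ _ [m ->] [n ->]; exists (m - n); rewrite mulrzBr.
Qed.

Lemma torsion_freeMn A x n : torsion_free_on A -> A x -> (0 < n)%N ->
  x *+ n = 0 -> x = 0.
Proof. by move=> tfA Ax n0 xn0; apply: tfA => //; exists n. Qed.

Lemma is_torsionMz x (m : int) : m != 0 -> x *~ m = 0 -> is_torsion x.
Proof.
case: m => n n0 xn0; first by exists n; rewrite lt0n.
by exists n.+1; split => //; apply/eqP; rewrite -oppr_eq0 pmulrn -mulrNz -NegzE xn0.
Qed.

Lemma torsion_freeMz A x (m : int) : torsion_free_on A -> A x -> m != 0 ->
  x *~ m = 0 -> x = 0.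
Proof. by move=> tfA Ax m0 xm0; apply: tfA => //; exact: is_torsionMz xm0. Qed.

Lemma torsion_free_inj A x y n : subgroup A -> torsion_free_on A -> A x -> A y ->
  (0 < n)%N -> x *+ n = y *+ n -> x = y.
Proof.
move=> sA tfA Ax Ay n0 exy; apply/eqP; rewrite -subr_eq0; apply/eqP.
apply: (@torsion_freeMn A _ n) => //; first exact: sgrpB.
by rewrite mulrnBl exy subrr.
Qed.

Lemma dsumI C A B : subgroup A -> subgroup B -> subgroup C ->
  (forall x, A x -> C x) -> (forall x, B x -> C x) ->
  (forall x, A x -> B x -> x = 0) ->
  (forall x, C x -> exists2 a, A a & B (x - a)) ->
  direct_sum_of C A B.
Proof.
move=> sA sB sC AC BC AB CAB; do !split => //.
  by case/CAB=> a Aa Bxa; exists a, (x - a); do !split => //; rewrite addrC subrK.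
by case=> a [b [Aa [Bb ->]]]; apply: sgrpD => //; [exact: AC | exact: BC].
Qed.

(** The projection is a total function on [V], described only on [C]. It is additive there because
    the [A]-component of an element is unique ([fE]). *)
Lemma dsum_proj C A B : direct_sum_of C A B -> exists f : V -> V,
  [/\ forall x, C x -> A (f x), forall x, C x -> B (x - f x),
      forall x, A x -> f x = x, forall x, B x -> f x = 0 &
      forall x y, C x -> C y -> f (x - y) = f x - f y].
Proof.
case=> sA [sB [AB CAB]].
have /boolp.choice[f fP] x : exists a, C x -> A a /\ B (x - a).
  case: (EM (C x)) => [/CAB[a [b [Aa [Bb ->]]]]|nCx]; last by exists 0.
  by exists a => _; rewrite addrC addKr.
have AC x : A x -> C x.
  by move=> Ax; apply/CAB; exact: sumsgl.
have BC x : B x -> C x.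
  by move=> Bx; apply/CAB; exact: sumsgr.
have sC : subgroup C.
  have [s0 sB'] := sgrp_sumsg sA sB; split; first exact/CAB.
  by move=> x y /CAB Cx /CAB Cy; apply/CAB; exact: sB'.
have fE x a : C x -> A a -> B (x - a) -> f x = a.
  move=> Cx Aa Ba; have [Af Bf] := fP x Cx.
  apply/eqP; rewrite -subr_eq0; apply/eqP/AB; first exact: sgrpB.
  rewrite (_ : _ - a = (x - a) - (x - f x)); first exact: sgrpB.
  by rewrite opprB [RHS]addrC addrA subrK.
exists f; split=> [x /fP[]|x /fP[]|x Ax|x Bx|x y Cx Cy] //.
- by apply: fE; [exact: AC | | rewrite subrr; exact: sgrp0].
- by apply: fE; [exact: BC | exact: sgrp0 | rewrite subr0].
- have [Afx Bfx] := fP x Cx; have [Afy Bfy] := fP y Cy.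
  apply: fE; [exact: sgrpB| exact: sgrpB|].
  by rewrite opprD addrACA -opprD; exact: sgrpB.
Qed.

End Subgroups.

(** * Maximal disjoint subgroups and complements of divisible subgroups *)

Section Zorn.
Variable V : zmodType.
Implicit Types (A B C D H K P Q R : V -> Prop) (x y z : V).

(** By Zorn's lemma. The last clause is maximality in elementwise form: if adjoining an element of
    [C] to [M] keeps it disjoint from [Y], the element already lies in [M]. *)
Lemma max_disjoint C K Y :
  subgroup C -> subgroup K -> (forall x, K x -> C x) ->
  (forall x, K x -> Y x -> x = 0) ->
  exists M, [/\ subgroup M, forall x, K x -> M x, forall x, M x -> C x,
    forall x, M x -> Y x -> x = 0 &
    forall x, C x ->
      (forall y k, M y -> Y (y + x *~ k) -> y + x *~ k = 0) -> M x].
Proof.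
move=> sC sK KC KY.
(* [K] is joined to every member of the chain so that the empty chain has an upper bound. *)
pose U X := fun x : V => K x \/ X x.
pose Pr (X : classical_sets.set V) :=
  [/\ subgroup (U X), forall x, U X x -> C x & forall x, U X x -> Y x -> x = 0].
have [F FP Ftot|X [[sX XC XY] Xmax]] := @classical_sets.Zorn_bigcup V Pr.
  split.
  - split; first by left; exact: sgrp0.
    have aux X x y : F X -> U X x -> U X y ->
        U (classical_sets.bigcup F id) (x - y).
      move=> FX Xx Xy; have [sX _ _] := FP X FX.
      by case: (sgrpB sX Xx Xy) => ?; [left | right; exists X].
    move=> x y [Kx|[X FX Xx]] [Ky|[X' FX' Xy]].
    + by left; exact: sgrpB.
    + by apply: (aux X') => //; [left | right].
    + by apply: (aux X) => //; [right | left].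
    + case: (Ftot _ _ FX FX') => XX'.
        by apply: (aux X') => //; right => //; exact: XX'.
      by apply: (aux X) => //; right => //; exact: XX'.
  - by move=> x [/KC //|[X FX Xx]]; case: (FP X FX) => _ XC _; apply: XC; right.
  - move=> x [/KY //|[X FX Xx]]; case: (FP X FX) => _ _ XY; apply: XY; right => //.
exists (U X); split => //; first by left.
move=> x Cx xP; apply: contrapT => nXx.
pose B := sumsg (U X) (mults x).
have sB : subgroup B by exact: (sgrp_sumsg sX (sgrp_mults x)).
have XB y : U X y -> B y by move=> ?; apply: sumsgl => //; exact: sgrp_mults.
have UBE y : U B y <-> B y.
  by split=> [[Ky|//]|]; [apply: XB; left | right].
apply: (Xmax B).
  split=> [y Xy|BX]; first by apply: XB; right.
  by apply: nXx; right; apply: BX; apply: sumsgr => //; exists 1.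
split.
- split; first by apply/UBE; exact: sgrp0.
  by move=> y z /UBE By /UBE Bz; apply/UBE; exact: sgrpB.
- move=> y /UBE[a [_ [/XC Xa [[m ->] ->]]]]; apply: sgrpD => //; exact: sgrpMz.
- by move=> y /UBE[a [_ [Xa [[m ->] ->]]]]; exact: xP.
Qed.

Lemma prime_dvdz_or_bezout (p : nat) (j : int) : prime p ->
  (exists i, j = i * p%:Z) \/ (exists u v, u * j + v * p%:Z = 1).
Proof.
move=> pp; case: (boolP (p %| j)%Z) => [/dvdzP[i ->]|npj]; first by left; exists i.
right; have [u [v uv]] := Bezoutz j p; exists u, v; rewrite uv.
apply/eqP; change (coprimez j p); rewrite coprimezE coprime_sym prime_coprime //.
Qed.

Lemma divisible_primes A : subgroup A ->
  (forall x p, A x -> prime p -> exists2 y, A y & y *+ p = x) -> divisible_on A.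
Proof.
move=> sA Ap; split => // x n; have [m] := ubnP n.
elim: m => // m IHm in n x * => nm Ax n0.
case: (ltngtP n 1) n0 => // [n1 _|-> _]; last by exists x.
have pp := pdiv_prime n1; have [y Ay yx] := Ap x _ Ax pp.
have [] := IHm (n %/ pdiv n)%N y.
- by apply: (leq_trans (ltn_Pdiv (prime_gt1 pp) _)) => //; exact: ltnW.
- by [].
- by rewrite divn_gt0 ?pdiv_gt0 // dvdn_leq ?pdiv_dvd // ltnW.
move=> z [Az zy]; exists z; split => //.
by rewrite -yx -zy -mulrnA divnK // pdiv_dvd.
Qed.

(** Let [y] in [C] satisfy [p y = d]. If [a + j y] lies in [Y] and [p] divides [j], then it lies in
    [M] and is 0. Otherwise [p a + j d] lies in both [M] and [Y], so it is 0, and a Bezout relation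
    for [j] and [p] yields a [p]-th part of [d] in [M]. Hence either [M] contains such a part or
    maximality puts [y] in [M]. *)
Lemma max_disjoint_divisible C M Y : divisible_on C ->
  subgroup M -> subgroup Y -> (forall x, M x -> C x) ->
  (forall x, M x -> Y x -> x = 0) ->
  (forall x, C x ->
      (forall y k, M y -> Y (y + x *~ k) -> y + x *~ k = 0) -> M x) ->
  divisible_on M.
Proof.
move=> [sC Cdiv] sM sY MC MY Mmax; apply: divisible_primes => // d p Md pp.
have [y [Cy yd]] := Cdiv d p (MC _ Md) (prime_gt0 pp).
apply: contrapT => nd; apply: (nd); exists y => //; apply: Mmax => // a j Ma Yaj.
case: (prime_dvdz_or_bezout j pp) => [[i ji]|[u [v uv]]].
  apply: MY => //; apply: sgrpD => //.
  by rewrite ji mulrC mulrzA -pmulrn yd; exact: sgrpMz.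
have e0 : a *+ p + d *~ j = 0.
  have E : (a + y *~ j) *+ p = a *+ p + d *~ j.
    by rewrite mulrnDl -yd !pmulrn [y *~ j *~ _]mulrzAC.
  rewrite -E; apply: MY; last exact: sgrpMn.
  by rewrite E; apply: sgrpD => //; [exact: sgrpMn | exact: sgrpMz].
case: nd; exists (d *~ v - a *~ u).
  by apply: sgrpB => //; exact: sgrpMz.
have e1 : a *+ p = - (d *~ j) by apply/eqP; rewrite -addr_eq0 e0.
have e2 : a *~ u *~ p = - (d *~ (u * j)).
  by rewrite mulrzAC -pmulrn e1 mulNrz -mulrzA mulrC.
by rewrite pmulrn mulrzBl e2 opprK -mulrzA -mulrzDr addrC uv mulr1z.
Qed.

(** The sum [D + M] is closed under division by primes: the [D]-component of [p z] can be divided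
    inside [D], which reduces to [p z] in [M], where maximality and a Bezout relation apply. If [x]
    were outside the sum, no non-zero multiple of [x] could lie in it, so [x] could be adjoined to
    [M]. *)
Lemma divisible_complement D M : divisible_on D -> subgroup M ->
  (forall x, M x -> D x -> x = 0) ->
  (forall x,
      (forall y k, M y -> D (y + x *~ k) -> y + x *~ k = 0) -> M x) ->
  forall x, sumsg D M x.
Proof.
move=> [sD Ddiv] sM MD Mmax; pose S := sumsg D M.
have sS : subgroup S by exact: sgrp_sumsg.
have DS z : D z -> S z by exact: sumsgl.
have MS z : M z -> S z by exact: sumsgr.
have Sp p z : prime p -> S (z *+ p) -> S z.
  move=> pp [d [m [Dd [Mm zp]]]].
  have [d' [Dd' d'p]] := Ddiv d p Dd (prime_gt0 pp).
  suff Szd : S (z - d') by rewrite -(subrK d' z); apply: sgrpD => //; exact: DS.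
  have zd'p : (z - d') *+ p = m by rewrite mulrnBl zp d'p addrC addKr.
  apply: contrapT => nS; apply: (nS); apply/MS/Mmax => y j My Dyj.
  case: (prime_dvdz_or_bezout j pp) => [[i ji]|[u [v uv]]].
    apply: MD => //; apply: sgrpD => //.
    by rewrite ji mulrC mulrzA -pmulrn zd'p; exact: sgrpMz.
  case: nS; rewrite -[z - d']mulr1z -uv mulrzDr.
  apply: sgrpD => //; last first.
    by rewrite mulrC mulrzA -pmulrn zd'p; apply: MS; exact: sgrpMz.
  rewrite mulrC mulrzA; apply: sgrpMz => //.
  by apply: (@sgrpDl _ S y); [| exact: MS | exact: DS].
have Sn n z : (0 < n)%N -> S (z *+ n) -> S z.
  have [m] := ubnP n; elim: m => // m IHm in n z * => nm n0.
  case: (ltngtP n 1) n0 => // [n1 _|-> _]; last by rewrite mulr1n.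
  have pp := pdiv_prime n1.
  rewrite -(divnK (pdiv_dvd n)) mulrnA => /(Sp _ _ pp); apply: IHm.
    by apply: (leq_trans (ltn_Pdiv (prime_gt1 pp) _)) => //; exact: ltnW.
  by rewrite divn_gt0 ?pdiv_gt0 // dvdn_leq ?pdiv_dvd // ltnW.
move=> x; apply: contrapT => nSx; apply: (nSx); apply/MS/Mmax => y k My Dyk.
have Sxk : S (x *~ k) by apply: (@sgrpDl _ S y); [| exact: MS | exact: DS].
have [k0|k0] := eqVneq k 0.
  by rewrite k0 mulr0z addr0 in Dyk *; exact: MD.
case: nSx; apply: (Sn `|k|%N); first by rewrite absz_gt0.
by rewrite pmulrn abszE; case: (ger0P k) => _ //; rewrite mulrNz; exact: sgrpN.
Qed.

(** A subgroup contains the multiples of each of its elements, so essentiality can be tested on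
    cyclic subgroups. *)
Lemma essentialI H A : subgroup H -> (forall x, H x -> A x) ->
  (forall x, A x -> x <> 0 -> exists2 k : int, H (x *~ k) & x *~ k <> 0) ->
  essential_in H A.
Proof.
move=> sH HA Aess; do !split => //; try by case: sH.
move=> S sS SA [x [Sx x0]]; have [k Hxk xk0] := Aess x (SA x Sx) x0.
by exists (x *~ k); split => //; exact: sgrpMz.
Qed.

Lemma essentialE H A x : subgroup A -> essential_in H A -> A x -> x <> 0 ->
  exists2 k : int, H (x *~ k) & x *~ k <> 0.
Proof.
move=> sA [_ [_ Aess]] Ax x0.
have [||_ [[k ->] [Hk k0]]] := Aess _ (sgrp_mults x).
- by move=> _ [m ->]; exact: sgrpMz.
- by exists x; split => //; exists 1.
- by exists k.
Qed.

End Zorn.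

(** * Extending subgroups when the pure subgroups of the reduced part split *)

Section Splitting.
Variable V : zmodType.
Implicit Types (A B C D H K P Q R : V -> Prop) (x y z : V).

(** For a subgroup of a torsion-free group this agrees with ordinary purity, since division by [n]
    is then unique. *)
Definition pure_in P R := forall x n, R x -> (0 < n)%N -> P (x *+ n) -> P x.

Definition pure_split R := forall P, subgroup P -> (forall x, P x -> R x) ->
  pure_in P R -> exists Q, direct_sum_of R P Q.

Lemma dsumC C A B : direct_sum_of C A B -> direct_sum_of C B A.
Proof.
case=> sA [sB [AB CAB]]; split=> //; split=> //.
split=> [x Bx Ax|x]; first exact: AB.
split=> [/CAB|] [a [b [Aa [Bb ->]]]]; first by exists b, a; rewrite addrC.
by apply/CAB; exists b, a; rewrite addrC.
Qed.

Lemma dsum_subl C A B x : direct_sum_of C A B -> A x -> C x.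
Proof. by case=> sA [sB [AB CAB]] Ax; apply/CAB; exact: sumsgl. Qed.

Lemma dsum_subr C A B x : direct_sum_of C A B -> B x -> C x.
Proof. by move/dsumC; exact: dsum_subl. Qed.

Section AdditiveOn.
Variables (C : V -> Prop) (f : V -> V).
Hypotheses (sC : subgroup C) (fB : forall x y, C x -> C y -> f (x - y) = f x - f y).

Lemma additive_on0 : f 0 = 0.
Proof. by rewrite -(subrr 0) fB ?subrr //; exact: sgrp0. Qed.

Lemma additive_onN x : C x -> f (- x) = - f x.
Proof. by move=> Cx; rewrite -sub0r fB ?additive_on0 ?sub0r //; exact: sgrp0. Qed.

Lemma additive_onD x y : C x -> C y -> f (x + y) = f x + f y.
Proof.
move=> Cx Cy; rewrite -[y in LHS]opprK fB //; last exact: sgrpN.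
by rewrite additive_onN // opprK.
Qed.

Lemma additive_onMn x n : C x -> f (x *+ n) = f x *+ n.
Proof.
move=> Cx; elim: n => [|n IHn]; first by rewrite !mulr0n additive_on0.
by rewrite !mulrS additive_onD ?IHn //; exact: sgrpMn.
Qed.

Lemma additive_onMz x m : C x -> f (x *~ m) = f x *~ m.
Proof.
move=> Cx; case: m => n; first exact: additive_onMn.
by rewrite NegzE !mulrNz additive_onN; [rewrite additive_onMn | exact: sgrpMn].
Qed.

End AdditiveOn.

Lemma sgrpT : subgroup (fun _ : V => True). Proof. by []. Qed.

Lemma divisible_split_extending D R :
  direct_sum_of (fun _ => True) D R -> divisible_on D -> torsion_free_on R ->
  pure_split R ->
  forall H, subgroup H -> exists A, direct_summand A /\ essential_in H A.
Proof.
move=> VDR Ddiv tfR splitR H sH.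
have [sD [sR [DR _]]] := VDR.
have [f [fR fD fid f0 fB]] := dsum_proj (dsumC VDR).
have {fR}fR x : R (f x) by exact: fR.
have {fD}fD x : D (x - f x) by exact: fD.
have {fB}fB x y : f (x - y) = f x - f y by exact: fB.
have fMn x n : f (x *+ n) = f x *+ n.
  by apply: (additive_onMn sgrpT) => // ? ? _ _; exact: fB.
have fMz x n : f (x *~ n) = f x *~ n.
  by apply: (additive_onMz sgrpT) => // ? ? _ _; exact: fB.
have D0 x : f x = 0 -> D x by move=> fx0; rewrite -(subr0 x) -fx0.
(* The purification in [R] of the image of [H] under the projection [f]. *)
pose P x := R x /\ exists2 n, (0 < n)%N & exists2 h, H h & x *+ n = f h.
have sP : subgroup P.
  split.
    split; first exact: sgrp0.
    by exists 1%N => //; exists 0; [exact: sgrp0 | rewrite f0 ?mulr1n //; exact: sgrp0].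
  move=> x y [Rx [n n0 [h Hh xn]]] [Ry [m m0 [g Hg ym]]]; split; first exact: sgrpB.
  exists (n * m)%N; first by rewrite muln_gt0 n0.
  exists (h *+ m - g *+ n); first by apply: sgrpB => //; exact: sgrpMn.
  by rewrite fB !fMn -xn -ym -!mulrnA mulrnBl [(m * n)%N]mulnC.
have [|x n Rx n0 [_ [m m0 [h Hh xnm]]]|Q RPQ] := splitR P sP.
- by move=> x [].
- split => //; exists (n * m)%N; first by rewrite muln_gt0 n0.
  by exists h; rewrite // mulrnA.
have [_ [sQ [PQ RPQ']]] := RPQ.
have HP h : H h -> P (f h).
  by move=> Hh; split=> //; exists 1%N => //; exists h.
have [||||D1 [sD1 _ D1D D1H D1max]] := @max_disjoint V D (eq^~ 0) H.
- by case: Ddiv.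
- by split=> // x y -> ->; rewrite subr0.
- by move=> x ->; exact: sgrp0.
- by [].
have D1div := max_disjoint_divisible Ddiv sD1 sH D1D D1H D1max.
have [||||M [sM KM _ MD1 Mmax]] := @max_disjoint V (fun _ => True) (sumsg H Q) D1.
- by [].
- exact: sgrp_sumsg.
- by [].
(* The projection kills [D1], so [f h = - q] lies in both [P] and [Q]. Hence [q = 0], and [h] lies
   in both [D1] and [H]. *)
- move=> _ [h [q [Hh [Qq ->]]]] D1hq.
  have q0 : f h + q = 0.
    rewrite -(fid q); last exact: (dsum_subr RPQ).
    rewrite -(additive_onD sgrpT (fun x y _ _ => fB x y)) //.
    by apply: f0; exact: D1D.
  have Qfh : Q (f h).
    have -> : f h = - q by apply/eqP; rewrite -addr_eq0 q0.
    exact: sgrpN.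
  have fh0 : f h = 0 by apply: PQ => //; exact: HP.
  move: q0 D1hq; rewrite fh0 add0r => ->; rewrite addr0 => D1h; exact: D1H.
have HM x : H x -> M x by move=> Hx; apply: KM; exact: sumsgl.
have QM x : Q x -> M x by move=> Qx; apply: KM; exact: sumsgr.
have VD1M := divisible_complement D1div sM MD1 (fun x => Mmax x I).
have sDP : subgroup (sumsg D P) by exact: sgrp_sumsg.
(* The intersection of [M] with [D + P] has complement [D1 + Q]. *)
exists (fun x => M x /\ sumsg D P x); split.
  exists (sumsg D1 Q); apply: dsumI => //.
  - exact: sgrpI.
  - exact: sgrp_sumsg.
  - move=> a [Ma DPa] [d [q [D1d [Qq e]]]].
    have DPq : sumsg D P q.
      apply: (sgrpDl sDP (x := d)); first by apply: sumsgl => //; exact: D1D.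
      by rewrite -e.
    case: DPq => d' [p [Dd' [Pp qdp]]].
    have q0 : q = 0.
      have fq : f q = p.
        rewrite qdp (additive_onD sgrpT (fun x y _ _ => fB x y)) // f0 // add0r.
        by apply: fid; case: Pp.
      rewrite fid in fq; last exact: (dsum_subr RPQ).
      by apply: PQ => //; rewrite fq.
    by move: e Ma; rewrite q0 addr0 => -> Md; exact: MD1.
  move=> x _; have [d [m [D1d [Mm ->]]]] := VD1M x.
  have /RPQ'[p [q [Pp [Qq fm]]]] := fR m.
  (* Here [m - q = (m - f m) + p] lies in [D + P], and it stays in [M] because [M] contains [Q]. *)
  exists (m - q).
    split; first by apply: sgrpB => //; exact: QM.
    exists (m - f m), p; do !split => //; try by case: Pp.
    by rewrite fm [p + q]addrC opprD addrA subrK.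
  by exists d, q; rewrite opprB addrA addrAC addrK.
apply: essentialI => //.
  move=> h Hh; split; first exact: HM.
  by exists (h - f h), (f h); rewrite subrK; split => //; split=> //; exact: HP.
(* If no non-zero multiple of [x] were in [H], maximality would put [x] in [D1], which meets [M]
   trivially. *)
have essD x : M x -> D x -> x <> 0 -> exists2 k : int, H (x *~ k) & x *~ k <> 0.
  move=> Mx Dx x0; apply: contrapT => nk; apply: x0; apply/MD1 => //.
  apply: D1max => // y k D1y Hyxk.
  have y0 : y = 0.
    apply: MD1 => //; rewrite -(addrK (x *~ k) y); apply: sgrpB => //.
      exact: HM.
    exact: sgrpMz.
  rewrite y0 add0r in Hyxk *; apply: contrapT => xk0.
  by apply: nk; exists k.
move=> m [Mm [d [p [Dd [Pp mdp]]]]] m0.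
have fm : f m = p.
  rewrite mdp (additive_onD sgrpT (fun x y _ _ => fB x y)) // f0 // add0r.
  by apply: fid; case: Pp.
case: (EM (D m)) => [Dm|nDm]; first exact: essD.
have [Rp [n n0 [h Hh pn]]] := Pp.
(* Since [f] sends both [n m] and [h] to [n p], their difference lies in [M] and [D], and [essD]
   applies unless it is 0. Then [n k m] lies in [H]. *)
have [k k0 Hk] : exists2 k : int, k != 0 & H ((m *+ n - h) *~ k).
  have [->|/eqP x0] := eqVneq (m *+ n - h) 0; first by exists 1 => //; exact: sgrp0.
  have [||//|k Hk xk0] := essD (m *+ n - h).
  - by apply: sgrpB => //; [exact: sgrpMn | exact: HM].
  - by apply: D0; rewrite fB fMn fm pn subrr.
  by exists k => //; apply/eqP => k0; apply: xk0; rewrite k0 mulr0z.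
exists (n%:Z * k).
  rewrite mulrzA -pmulrn -(subrK h (m *+ n)) mulrzDl.
  by apply: sgrpD => //; exact: sgrpMz.
(* The image of [n k m] under [f] is [n k p]; as [R] is torsion-free, it vanishes only if [p = 0],
   that is, if [m] lies in [D]. *)
move=> e; apply: nDm; apply: D0; rewrite fm.
apply: (torsion_freeMz tfR Rp (m := n%:Z * k)).
  by rewrite mulf_neq0 // eqz_nat -lt0n.
by rewrite -fm -fMz e f0 //; exact: sgrp0.
Qed.

End Splitting.

(** * Divisibility and heights inside a torsion-free subgroup *)

Section Divisibility.
Variables (V : zmodType) (R : V -> Prop).
Hypothesis sR : subgroup R.
Implicit Types (x y z : V) (m n p q k : nat).

(** [pdiv_in R p k] is convertible to [dvdin (p ^ k)], so what follows applies to heights as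
    well. *)
Definition dvdin n x := exists y, R y /\ y *+ n = x.

Lemma coprime_bezoutz m n : coprime m n -> exists u v : int, u * m%:Z + v * n%:Z = 1.
Proof.
move=> cmn; have [u [v uv]] := Bezoutz m n; exists u, v; rewrite uv.
by apply/eqP; change (coprimez m n); rewrite coprimezE.
Qed.

Lemma dvdin_dvdn m n x : (m %| n)%N -> dvdin n x -> dvdin m x.
Proof.
case/dvdnP=> k -> [y [Ry <-]]; exists (y *+ k); rewrite -mulrnA.
by split=> //; exact: sgrpMn.
Qed.

Lemma dvdinMz n x (c : int) : dvdin n x -> dvdin n (x *~ c).
Proof.
case=> y [Ry <-]; exists (y *~ c); split; first exact: sgrpMz.
by rewrite !pmulrn mulrzAC.
Qed.

Lemma dvdinD n x y : dvdin n x -> dvdin n y -> dvdin n (x + y).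
Proof.
case=> a [Ra <-] [b [Rb <-]]; exists (a + b); rewrite mulrnDl.
by split => //; exact: sgrpD.
Qed.

Lemma dvdinB n x y : dvdin n x -> dvdin n y -> dvdin n (x - y).
Proof.
case=> a [Ra <-] [b [Rb <-]]; exists (a - b); rewrite mulrnBl.
by split => //; exact: sgrpB.
Qed.

Lemma dvdin_lcm m n x : coprime m n -> dvdin m x -> dvdin n x -> dvdin (m * n) x.
Proof.
move=> /coprime_bezoutz[u [v uv]] [y [Ry ym]] [z [Rz zn]].
exists (z *~ u + y *~ v); split; first by apply: sgrpD => //; exact: sgrpMz.
rewrite -[RHS]mulr1z -uv mulrzDr mulrnDl; congr (_ + _).
  by rewrite -zn !pmulrn -!mulrzA PoszM [Posz m * _]mulrC mulrCA.
by rewrite -ym !pmulrn -!mulrzA PoszM mulrCA.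
Qed.

Lemma dvdin_coprime n c z : coprime n c -> R z -> dvdin n (z *+ c) -> dvdin n z.
Proof.
move=> /coprime_bezoutz[u [v uv]] Rz nzc.
rewrite -[z]mulr1z -uv mulrzDr; apply: dvdinD.
  by exists (z *~ u); rewrite mulrzA; split => //; exact: sgrpMz.
by rewrite mulrC mulrzA; exact: dvdinMz.
Qed.

Hypothesis tfR : torsion_free_on R.

Lemma dvdin_pmul2 c n z : (0 < c)%N -> R z ->
  dvdin (c * n) (z *+ c) <-> dvdin n z.
Proof.
move=> c0 Rz; split=> -[y [Ry yz]]; exists y; split=> //.
  apply: (torsion_free_inj sR tfR _ Rz c0); first exact: sgrpMn.
  by rewrite -mulrnA mulnC.
by rewrite -yz -mulrnA mulnC.
Qed.

Lemma pdiv_height p x : R x -> ~ (forall k, pdiv_in R p k x) ->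
  exists h, pdiv_in R p h x /\ forall k, pdiv_in R p k x <-> (k <= h)%N.
Proof.
move=> Rx /boolp.existsNP[k nk].
have [h [hx nhx]] : exists h, pdiv_in R p h x /\ ~ pdiv_in R p h.+1 x.
  elim: k nk => [|k IHk] nk; first by case: nk; exists x; rewrite mulr1n.
  by case: (EM (pdiv_in R p k x)) => [kx|/IHk //]; exists k.
exists h; split=> // j; split=> [jx|jh].
  rewrite leqNgt; apply/negP => hj; apply: nhx.
  by apply: dvdin_dvdn jx; exact: dvdn_exp2l.
by apply: dvdin_dvdn hx; exact: dvdn_exp2l.
Qed.

(** If the heights are finite, say [h] for [x] and [l] for [y = p^l z], take [y' = p^h z]; powers of
    [p] do not affect divisibility by powers of another prime. If they are infinite, [y] itself
    works. *)
Lemma adjust_height p x y : prime p -> R x -> R y -> y <> 0 ->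
  ((forall k, pdiv_in R p k x) <-> (forall k, pdiv_in R p k y)) ->
  exists y', [/\ R y', y' <> 0,
    exists a b, [/\ (0 < a)%N, (0 < b)%N & y' *+ a = y *+ b],
    forall k, pdiv_in R p k x <-> pdiv_in R p k y' &
    forall q, prime q -> q <> p -> forall k, pdiv_in R q k y <-> pdiv_in R q k y'].
Proof.
move=> pp Rx Ry y0 xy.
case: (EM (forall k, pdiv_in R p k x)) => [xi|nxi].
  exists y; split=> //; first by exists 1%N, 1%N.
  by move=> k; split=> _; [exact: (proj1 xy xi) | exact: xi].
have nyi : ~ (forall k, pdiv_in R p k y) by move/xy.
have [h [_ hP]] := pdiv_height Rx nxi.
have [l [[z [Rz zy]] lP]] := pdiv_height Ry nyi.
have p0 k : (0 < p ^ k)%N by rewrite expn_gt0 prime_gt0.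
have z0 : z <> 0 by move=> z0; apply: y0; rewrite -zy z0 mul0rn.
exists (z *+ p ^ h); split.
- exact: sgrpMn.
- by move=> e; apply: z0; apply: (torsion_freeMn tfR Rz _ e).
- by exists (p ^ l)%N, (p ^ h)%N; rewrite -zy -!mulrnA mulnC.
- move=> k; rewrite hP; split=> [kh|kz].
    by apply: (dvdin_dvdn (dvdn_exp2l p kh)); exists z.
  rewrite leqNgt; apply/negP => hk.
  suff /lP : pdiv_in R p l.+1 y by rewrite ltnn.
  rewrite /pdiv_in expnSr -zy; apply/dvdin_pmul2 => //.
  apply/(dvdin_pmul2 p (p0 h) Rz); rewrite -expnSr.
  by apply: dvdin_dvdn kz; exact: dvdn_exp2l.
- move=> q pq qp k; rewrite -zy.
  have cop j : coprime (q ^ k) (p ^ j).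
    apply: coprimeXl; apply: coprimeXr; rewrite prime_coprime // dvdn_prime2 //.
    exact/eqP.
  have E j : dvdin (q ^ k) (z *+ p ^ j) <-> dvdin (q ^ k) z.
    by split=> [/(dvdin_coprime (cop j) Rz) //|]; rewrite pmulrn; exact: dvdinMz.
  by split=> /E zk; apply/E.
Qed.

(** Strong induction on [n], splitting off the full power of its smallest prime factor and
    recombining with [dvdin_lcm]. *)
Lemma dvdin_primes x y :
  (forall p k, prime p -> pdiv_in R p k x -> pdiv_in R p k y) -> R y ->
  forall n, (0 < n)%N -> dvdin n x -> dvdin n y.
Proof.
move=> xy Ry n; have [m] := ubnP n; elim: m => // m IHm in n * => nm n0 nx.
case: (ltngtP n 1) n0 nm nx => // [n1 _|-> _ _ _]; last by exists y.
have pp := pdiv_prime n1; set p := pdiv n in pp.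
have n0 := ltnW n1.
have [c cp ->] := pfactor_coprime pp n0.
have k0 : (0 < logn p n)%N by rewrite logn_gt0 mem_primes pp n0 pdiv_dvd.
set k := logn p n in k0 *.
have c0 : (0 < c)%N by case: c cp => //; rewrite /coprime gcdn0 => /eqP p1; rewrite p1 in pp.
move=> nm nx; apply: dvdin_lcm.
- by rewrite coprime_sym; exact: coprimeXl.
- apply: IHm => //; last by apply: dvdin_dvdn nx; exact: dvdn_mulr.
  rewrite ltnS in nm; apply: leq_trans nm; rewrite -[X in (X < _)%N]muln1 ltn_pmul2l //.
  by rewrite -(exp1n k) ltn_exp2r // prime_gt1.
- by apply: xy => //; apply: dvdin_dvdn nx; exact: dvdn_mull.
Qed.

(** Elements of equal type differ in height at finitely many primes only, and [adjust_height]
    repairs these one at a time. The relation between [y'] and [y] keeps [y'] in every pure subgroup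
    that contains [y]. *)
Lemma same_type_adjust x y : R x -> R y -> y <> 0 -> same_type R x y ->
  exists y', [/\ R y', y' <> 0,
    exists a b, [/\ (0 < a)%N, (0 < b)%N & y' *+ a = y *+ b] &
    forall n, (0 < n)%N -> dvdin n x <-> dvdin n y'].
Proof.
move=> Rx Ry y0 [xyi [N xyN]].
(* Induction on [M]: primes below [M] are already repaired, and at the others the heights of [y] are
   untouched. *)
suff /(_ N)[y' [Ry' y'0 yy' E1 E2]] : forall M, exists y', [/\ R y', y' <> 0,
    exists a b, [/\ (0 < a)%N, (0 < b)%N & y' *+ a = y *+ b],
    forall p, prime p -> (p < M)%N -> forall k, pdiv_in R p k x <-> pdiv_in R p k y' &
    forall p, prime p -> (M <= p)%N -> forall k, pdiv_in R p k y <-> pdiv_in R p k y'].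
  exists y'; split=> //.
  have E p k : prime p -> pdiv_in R p k x <-> pdiv_in R p k y'.
    move=> pp; case: (ltnP p N) => pN; first exact: E1.
    by rewrite xyN // E2.
  move=> n n0; split; apply: dvdin_primes => //.
    by move=> p k pp /(E _ _ pp).
  by move=> p k pp /(E _ _ pp).
elim=> [|M [y' [Ry' y'0 [a [b [a0 b0 yy']]] E1 E2]]].
  by exists y; split=> //; exists 1%N, 1%N.
case: (boolP (prime M)) => [pM|npM]; last first.
  exists y'; split=> //; first by exists a, b.
    move=> p pp; rewrite ltnS leq_eqVlt => /predU1P[e|]; last exact: E1.
    by rewrite -e pp in npM.
  by move=> p pp /ltnW; exact: E2.
have [|z [Rz z0 [c [d [c0 d0 zy']]] F1 F2]] := adjust_height pM Rx Ry' y'0.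
  have e k : pdiv_in R M k y <-> pdiv_in R M k y' by exact: E2.
  by rewrite (xyi M pM); split=> yi k; apply/e.
exists z; split=> //.
- exists (c * a)%N, (b * d)%N; split; rewrite ?muln_gt0 ?c0 ?b0 //.
  by rewrite mulrnA zy' mulrnAC yy' -mulrnA.
- move=> p pp; rewrite ltnS leq_eqVlt => /predU1P[-> //|pM'] k.
  by rewrite E1 // F2 // => e; rewrite e ltnn in pM'.
- move=> p pp Mp k; rewrite E2 //; last exact: ltnW.
  by apply: F2 => // e; rewrite e ltnn in Mp.
Qed.

End Divisibility.

(** * Integral linear combinations, independence and purification *)

Lemma int_mx_kernel k m (C : 'M[int]_(k, m)) : (m < k)%N ->
  exists2 w : 'rV[int]_k, w != 0 & w *m C = 0.
Proof.
move=> mk; have [L uL [U uU [d _ ->]]] := int_Smith_normal_form C.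
(* In [C = L D U], the diagonal factor has more rows than columns, so its row of index [m] is 0 and
   the same row of the inverse of [L] annihilates [C]. *)
pose j := Ordinal mk; exists (row j (invmx L)).
  apply/eqP => e; have : (row j (invmx L) *m L) 0 j = 0 by rewrite e mul0mx mxE.
  by rewrite -row_mul mulVmx // !mxE eqxx.
rewrite -row_mul !mulmxA mulVmx // mul1mx row_mul.
suff -> : row j (\matrix_(i, j) (d`_i *+ (i == j :> nat))) = 0 :> 'rV[int]_m.
  by rewrite mul0mx.
by apply/rowP => i; rewrite !mxE /= gtn_eqF.
Qed.

Lemma ex_max_nat (Q : nat -> Prop) n : Q 0%N -> (forall k, Q k -> (k <= n)%N) ->
  exists k, Q k /\ forall k', Q k' -> (k' <= k)%N.
Proof.
move=> Q0; elim: n => [|n IHn] Qn; first by exists 0%N.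
case: (EM (Q n.+1)) => [Qn1|nQ]; first by exists n.+1.
apply: IHn => k Qk; have := Qn k Qk; rewrite leq_eqVlt => /predU1P[e|//].
by rewrite e in Qk.
Qed.

Section LinearCombinations.
Variable V : zmodType.
Implicit Types (K P R : V -> Prop) (x y : V).

Definition lcomb n (a : 'I_n -> V) m (M : 'M[int]_(m, n)) (j : 'I_m) : V :=
  \sum_i a i *~ M j i.

Lemma lcombM n m k (a : 'I_n -> V) (M : 'M_(k, m)) (N : 'M_(m, n)) j :
  lcomb a (M *m N) j = lcomb (lcomb a N) M j.
Proof.
rewrite /lcomb; under eq_bigr do rewrite mxE mulrz_sumr.
rewrite exchange_big; apply: eq_bigr => i _; rewrite mulrz_suml.
by apply: eq_bigr => l _; rewrite mulrC mulrzA.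
Qed.

Lemma lcomb1 n (a : 'I_n -> V) j : lcomb a 1%:M j = a j.
Proof.
rewrite /lcomb (bigD1 j) //= mxE eqxx mulr1z big1 ?addr0 // => i ij.
by rewrite mxE eq_sym (negPf ij) mulr0z.
Qed.

Lemma sgrp_lcomb K n (a : 'I_n -> V) m (M : 'M_(m, n)) j : subgroup K ->
  (forall i, K (a i)) -> K (lcomb a M j).
Proof. by move=> sK Ka; apply: sgrp_sum => // i _; exact: sgrpMz. Qed.

Definition free_fam n (a : 'I_n -> V) :=
  forall c : 'I_n -> int, \sum_i a i *~ c i = 0 -> forall i, c i = 0.

Definition span_on n (a : 'I_n -> V) (J : pred 'I_n) x :=
  exists2 c : 'I_n -> int, (forall i, ~~ J i -> c i = 0) & x = \sum_i a i *~ c i.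

Lemma sgrp_span_on n (a : 'I_n -> V) J : subgroup (span_on a J).
Proof.
split.
  by exists (fun=> 0) => //; rewrite big1 // => i _; rewrite mulr0z.
move=> _ _ [c cJ ->] [d dJ ->]; exists (fun i => c i - d i).
  by move=> i nJi; rewrite cJ // dJ // subr0.
by rewrite -sumrB; apply: eq_bigr => i _; rewrite mulrzBr.
Qed.

Lemma span_onP n (a : 'I_n -> V) x : span_on a predT x ->
  exists w : 'rV[int]_n, x = lcomb a w 0.
Proof.
case=> c _ ->; exists (\row_i c i); apply: eq_bigr => i _; by rewrite mxE.
Qed.

Lemma span_on_self n (a : 'I_n -> V) (J : pred 'I_n) i : J i -> span_on a J (a i).
Proof.
move=> Ji; exists (fun j => (j == i)%:R).
  by move=> j; case: eqVneq => // ->; rewrite Ji.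
rewrite (bigD1 i) //= eqxx mulr1z big1 ?addr0 // => j /negPf ->.
by rewrite mulr0z.
Qed.

(** The purification of [K] in all of [V]; it is intersected with [R] when a purification inside [R]
    is wanted. *)
Definition pclos K x := exists2 N, (0 < N)%N & K (x *+ N).

Lemma sgrp_pclos K : subgroup K -> subgroup (pclos K).
Proof.
move=> sK; split; first by exists 1%N => //; exact: sgrp0.
move=> x y [n n0 Kx] [m m0 Ky]; exists (n * m)%N; first by rewrite muln_gt0 n0.
rewrite mulrnBl mulrnA mulnC mulrnA.
by apply: sgrpB => //; exact: sgrpMn.
Qed.

Lemma pclosMz K x (m : int) : subgroup K -> m != 0 -> K (x *~ m) -> pclos K x.
Proof.
move=> sK m0 Kxm; exists `|m|%N; first by rewrite absz_gt0.
by rewrite pmulrn abszE; case: (ger0P m) => _ //; rewrite mulrNz; exact: sgrpN.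
Qed.

(** Multiples of the [t j] are the rows of an integer matrix over [s]. With more rows than columns,
    [int_mx_kernel] would give a non-trivial relation among the [t j]. *)
Lemma free_fam_leq m k (s : 'I_m -> V) (t : 'I_k -> V) :
  (forall j, pclos (span_on s predT) (t j)) -> free_fam t -> (k <= m)%N.
Proof.
move=> st ft; rewrite leqNgt; apply/negP => mk.
have /boolp.choice[NC NCP] j : exists NC : nat * 'rV[int]_m,
    (0 < NC.1)%N /\ t j *+ NC.1 = lcomb s NC.2 0.
  by have [N N0 /span_onP[w e]] := st j; exists (N, w).
have [w w0 wC] := int_mx_kernel (\matrix_(j, i) (NC j).2 0 i) mk.
case/eqP: w0; apply/rowP => j; rewrite !mxE.
have : (w 0 j) * (NC j).1%:Z = 0.
  apply: (ft (fun j => w 0 j * (NC j).1%:Z)).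
  have e : lcomb s (w *m \matrix_(j, i) (NC j).2 0 i) 0 = 0.
    by rewrite wC /lcomb big1 // => i _; rewrite mxE mulr0z.
  rewrite -[RHS]e lcombM /lcomb; apply: eq_bigr => i _; rewrite mulrC mulrzA -pmulrn.
  have [_ ->] := NCP i; congr (_ *~ _); rewrite /lcomb.
  by apply: eq_bigr => l _; rewrite mxE.
move/eqP; rewrite mulf_eq0 => /orP[/eqP //|]; rewrite eqz_nat.
by have [+ _] := NCP j; case: (NC j).1.
Qed.

Lemma free_famMn n (a : 'I_n -> V) (N : 'I_n -> nat) : free_fam a ->
  (forall i, (0 < N i)%N) -> free_fam (fun i => a i *+ N i).
Proof.
move=> fa N0 c e i.
have : (N i)%:Z * c i = 0.
  apply: (fa (fun i => (N i)%:Z * c i)); rewrite -[RHS]e.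
  by apply: eq_bigr => j _; rewrite mulrzA -pmulrn.
by move/eqP; rewrite mulf_eq0 eqz_nat -leqn0 leqNgt N0 => /eqP.
Qed.

Definition ext_fam n x (s : 'I_n -> V) (i : 'I_n.+1) : V :=
  if unlift ord0 i is Some j then s j else x.

Lemma free_ext_fam n x (s : 'I_n -> V) : free_fam s ->
  ~ pclos (span_on s predT) x -> free_fam (ext_fam x s).
Proof.
move=> fs nx c; rewrite big_ord_recl /ext_fam unlift_none.
under eq_bigr do rewrite liftK.
move=> e.
have c0 : c ord0 = 0.
  apply: contrapT => /eqP c0; apply: nx; apply: (pclosMz _ c0).
    exact: sgrp_span_on.
  move/eqP: e; rewrite addr_eq0 => /eqP ->.
  by apply: sgrpN; [exact: sgrp_span_on | exists (fun i => c (lift ord0 i))].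
rewrite c0 mulr0z add0r in e => i.
by case: (unliftP ord0 i) => [j|] -> //; exact: (fs (fun j => c (lift ord0 j))).
Qed.

End LinearCombinations.

(** * Splitting pure subgroups by the Smith normal form *)

Section PureSplit.
Variable V : zmodType.
Implicit Types (K P R : V -> Prop) (x y : V).

Lemma sgrp_dvdin R n : subgroup R -> subgroup (dvdin R n).
Proof.
move=> sR; split; first by exists 0; rewrite mul0rn; split=> //; exact: sgrp0.
by move=> x y; exact: dvdinB.
Qed.

Lemma pure_in_pclos P R x : pure_in P R -> R x -> pclos P x -> P x.
Proof. by move=> pP Rx [N N0]; exact: pP. Qed.

Lemma coprime_relation R x y N (m : int) : subgroup R -> torsion_free_on R ->
  R x -> R y -> (0 < N)%N -> x *+ N = y *~ m ->
  exists N' m', [/\ (0 < N')%N, coprime N' `|m'|%N & x *+ N' = y *~ m'].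
Proof.
move=> sR tfR Rx Ry N0 e; pose g := gcdn N `|m|%N.
have g0 : (0 < g)%N by rewrite gcdn_gt0 N0.
have gm : (g%:Z %| m)%Z by rewrite dvdzE /= dvdn_gcdr.
exists (N %/ g)%N, (m %/ g)%Z; split.
- by rewrite divn_gt0 // dvdn_leq // dvdn_gcdl.
- have -> : `|(m %/ g)%Z|%N = (`|m| %/ g)%N.
    by rewrite -{2}(divzK gm) abszM /= mulnK.
  rewrite /coprime -(eqn_pmul2l g0) muln_gcdr muln1 ![(g * _)%N]mulnC.
  by rewrite !divnK ?dvdn_gcdl ?dvdn_gcdr.
- apply: (torsion_free_inj sR tfR _ _ g0); [exact: sgrpMn | exact: sgrpMz|].
  by rewrite -mulrnA divnK ?dvdn_gcdl // e pmulrn -mulrzA divzK.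
Qed.

(** Smith reduction of a maximal independent family of [P] replaces [a] by a unimodularly equivalent
    family [b] such that [P] is the purification of some of the [b j]; the others give the
    complement. Equal divisibility of the [a i] passes to every [b j], so that fractions of the
    [a i] also decompose along [b]. *)
Lemma homogeneous_basis_pure_split R n (a : 'I_n -> V) :
  subgroup R -> torsion_free_on R -> (forall i, R (a i)) -> free_fam a ->
  (forall i j N, (0 < N)%N -> dvdin R N (a i) -> dvdin R N (a j)) ->
  (forall x, R x -> exists2 f : 'I_n -> V, x = \sum_i f i &
     forall i, R (f i) /\ exists2 N, (0 < N)%N & exists m, f i *+ N = a i *~ m) ->
  pure_split R.
Proof.
move=> sR tfR Ra fa adiv agen P sP PR pP.
have Rspan x : R x -> pclos (span_on a predT) x.
  move=> /agen[f -> fP]; apply: sgrp_sum; first exact/sgrp_pclos/sgrp_span_on.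
  move=> i _; have [_ [N N0 [m e]]] := fP i; exists N => //; rewrite e.
  by apply: sgrpMz; [exact: sgrp_span_on | exact: span_on_self].
(* A maximal independent family of [P], whose size is bounded by [n]; it is rescaled next into
   integral combinations of [a]. *)
have [k [[s [Ps fs]] kmax]] : exists k,
    (exists s : 'I_k -> V, (forall i, P (s i)) /\ free_fam s) /\
    forall k', (exists s : 'I_k' -> V, (forall i, P (s i)) /\ free_fam s) -> (k' <= k)%N.
  apply: (ex_max_nat (n := n)).
    by exists (fun=> 0); split=> [|c _] [].
  move=> k [s [Ps fs]]; apply: (free_fam_leq (s := a) _ fs) => j.
  exact/Rspan/PR.
have {Ps fs}[s' [Ps' fs' [M Ms']]] : exists s' : 'I_k -> V,
    [/\ forall i, P (s' i), free_fam s' &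
     exists M : 'M[int]_(k, n), forall j, s' j = lcomb a M j].
  have /boolp.choice[NC NCP] j : exists NC : nat * 'rV[int]_n,
      (0 < NC.1)%N /\ s j *+ NC.1 = lcomb a NC.2 0.
    by have [N N0 /span_onP[w e]] := Rspan _ (PR _ (Ps j)); exists (N, w).
  exists (fun j => s j *+ (NC j).1); split.
  - by move=> j; exact: sgrpMn.
  - by apply: free_famMn => // j; case: (NCP j).
  exists (\matrix_(j, i) (NC j).2 0 i) => j; have [_ ->] := NCP j.
  by apply: eq_bigr => i _; rewrite mxE.
have Pspan x : P x -> pclos (span_on s' predT) x.
  move=> Px; apply: contrapT => nx.
  suff : (k.+1 <= k)%N by rewrite ltnn.
  apply: kmax; exists (ext_fam x s'); split; last exact: free_ext_fam.
  by move=> i; rewrite /ext_fam; case: (unlift ord0 i).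
have [L uL [U uU [d _ MLDU]]] := int_Smith_normal_form M.
set Dg := (\matrix_(i, j) _) in MLDU.
pose b := lcomb a U.
have ab i : a i = lcomb b (invmx U) i by rewrite -lcombM mulVmx // lcomb1.
have fb : free_fam b.
  move=> c e; pose v := \row_i c i.
  have e' : lcomb a (v *m U) 0 = 0.
    by rewrite lcombM -[RHS]e; apply: eq_bigr => i _; rewrite mxE.
  have vU : v *m U = 0 by apply/rowP => i; rewrite (fa _ e') mxE.
  move=> i; have : v = 0 by rewrite -(mulmxK uU v) vU mul0mx.
  by move/rowP/(_ i); rewrite !mxE.
(* The columns in which the diagonal factor is non-zero; the bound [j < k] reflects that it has only
   [k] rows. *)
pose J (j : 'I_n) := (j < k)%N && (d`_j != 0).
have DgJ (w : 'rV[int]_k) j : ~~ J j -> (w *m Dg) 0 j = 0.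
  rewrite negb_and -leqNgt negbK => nJ; rewrite mxE big1 // => i _.
  rewrite mxE; case: eqVneq => [e|]; last by rewrite mulr0.
  case/orP: nJ => [kj|/eqP dj0]; last by rewrite e dj0 mul0rn mulr0.
  by have := ltn_ord i; rewrite e ltnNge kj.
have PJ x : P x -> pclos (span_on b J) x.
  move=> /Pspan[N N0 /span_onP[w e]]; exists N => //; rewrite e.
  exists ((w *m L *m Dg) 0); first by move=> j; exact: DgJ.
  rewrite -[RHS]/(lcomb b (w *m L *m Dg) 0) -lcombM -!mulmxA [L *m _]mulmxA -MLDU.
  by rewrite lcombM; apply: eq_bigr => i _; rewrite Ms'.
have Rb j : R (b j) by exact: sgrp_lcomb.
(* The multiple of [b j] by its diagonal entry is a row of [Dg U a], which equals [L^-1 M a] and so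
   consists of combinations of the [s']. Purity removes the factor. *)
have Pb j : J j -> P (b j).
  case/andP=> jk dj0; apply: (pure_in_pclos pP) => //; apply: (pclosMz sP dj0).
  pose i := Ordinal jk.
  have -> : b j *~ d`_j = lcomb b Dg i.
    rewrite /lcomb (bigD1 j) //= big1 ?addr0 => [|l lj]; rewrite mxE /= ?eqxx //.
    by rewrite eq_sym (negPf (lj : (l : nat) != j)) mulr0z.
  rewrite -lcombM.
  have -> : Dg *m U = invmx L *m M by rewrite MLDU !mulmxA mulVmx // mul1mx.
  by rewrite lcombM; apply: sgrp_lcomb => // l; rewrite -Ms'.
pose Q x := R x /\ pclos (span_on b (predC J)) x.
have sQ : subgroup Q by apply: sgrpI => //; exact/sgrp_pclos/sgrp_span_on.
exists Q; apply: dsumI => //; first by move=> x [].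
  move=> x /[dup] /PR Rx /PJ[N N0 eN] [_ [N' N'0 eN']].
  have [c cJ e] : span_on b J (x *+ (N * N')).
    by rewrite mulrnA; apply: sgrpMn => //; exact: sgrp_span_on.
  have [c' c'J e'] : span_on b (predC J) (x *+ (N * N')).
    by rewrite mulnC mulrnA; apply: sgrpMn => //; exact: sgrp_span_on.
  apply: (torsion_freeMn tfR Rx (n := N * N')); first by rewrite muln_gt0 N0.
  rewrite e big1 // => i _.
  suff -> : c i = 0 by rewrite mulr0z.
  case: (boolP (J i)) => [Ji|]; last exact: cJ.
  have : c i - c' i = 0.
    apply: (fb (fun i => c i - c' i)).
    under eq_bigr do rewrite mulrzBr.
    by rewrite sumrB -e -e' subrr.
  by rewrite c'J ?subr0 //= negbK.
suff PQ x : R x -> sumsg P Q x.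
  by move=> x /PQ[y [z [Py [Qz ->]]]]; exists y => //; rewrite addrC addKr.
have sPQ : subgroup (sumsg P Q) by exact: sgrp_sumsg.
move=> /agen[f -> fP]; apply: sgrp_sum => // i _.
have [Rfi [N0 N00 [m0 e0]]] := fP i.
(* In lowest terms [N f_i = m a_i], so [N] divides [a i] in [R], hence every [a l] and every
   [b j]. *)
have [N [m [N_gt0 cNm e]]] := coprime_relation sR tfR Rfi (Ra i) N00 e0.
have Na : dvdin R N (a i).
  apply: (dvdin_coprime sR cNm) => //.
  have : dvdin R N (a i *~ m) by exists (f i).
  rewrite pmulrn abszE; case: (ger0P m) => _ //; rewrite mulrNz => ?.
  by apply: sgrpN => //; exact: sgrp_dvdin.
have /boolp.choice[c cP] j : exists y, R y /\ y *+ N = b j.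
  by apply: (@sgrp_lcomb _ (dvdin R N)); [exact: sgrp_dvdin | move=> l; exact: adiv Na].
(* The expansion of [m a_i] in [b], divided by [N] term by term. *)
have -> : f i = \sum_j c j *~ (invmx U i j * m).
  apply: (torsion_free_inj sR tfR _ _ N_gt0) => //.
    by apply: sgrp_sum => // j _; apply: sgrpMz => //; case: (cP j).
  rewrite e {1}ab mulrz_suml pmulrn mulrz_suml.
  apply: eq_bigr => j _; have [_ <-] := cP j.
  by rewrite -!mulrzA pmulrn -!mulrzA [in RHS]mulrC ?mulrA.
apply: sgrp_sum => // j _; apply: sgrpMz => //.
have [Rc cb] := cP j.
case: (boolP (J j)) => Jj.
  by apply: sumsgl => //; apply: (pP _ N) => //; rewrite cb; exact: Pb.
apply: sumsgr => //; split => //; exists N => //; rewrite cb.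
exact: span_on_self.
Qed.

End PureSplit.

(** * Homogeneous completely decomposable groups of finite rank *)

Section Decomposable.
Variable V : zmodType.
Implicit Types (K P R : V -> Prop) (x y : V).

Lemma free_fam_independent n (a : 'I_n -> V) : free_fam a ->
  exists s : seq V, [/\ size s = n, forall x, x \in s -> exists i, x = a i & independent s].
Proof.
move=> fa; exists [seq a i | i <- enum 'I_n]; set s := [seq _ | _ <- _].
have sz : size s = n by rewrite size_map size_enum_ord.
split=> // [x /mapP[i _ ->]|c]; first by exists i.
have cbij : bijective (cast_ord (esym sz)).
  by exists (cast_ord sz) => i; rewrite ?cast_ordK ?cast_ordKV.
rewrite (reindex _ (onW_bij _ cbij)) /=.
have sa (j : 'I_n) : s`_j = a j.
  by rewrite (nth_map j) ?size_enum_ord // nth_ord_enum.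
under eq_bigr do rewrite sa.
move=> /(fa (fun j => c (cast_ord (esym sz) j))) c0 i.
by rewrite -(cast_ordK sz i).
Qed.

(** Finite rank makes the index type finite; homogeneity lets the generators of the rank-one
    summands be rescaled to have the same divisors. Then [homogeneous_basis_pure_split] applies. *)
Lemma homogeneous_decomposable_pure_split R :
  torsion_free_on R -> fully_decomposable_on R -> homogeneous_on R ->
  finite_rank_on R -> pure_split R.
Proof.
move=> tfR [sR [I [F [F1 [FR [gen uniq]]]]]] homR [n rkR].
have sF i : subgroup (F i) by case: (F1 i).
have /boolp.choice[al alP] i : exists x, F i x /\ x <> 0.
  by case: (F1 i) => _ [_ [[x Fx] _]]; exists x.
have free_sec m (idx : 'I_m -> I) (a : 'I_m -> V) :
    (forall j k, idx j = idx k -> j = k) -> (forall j, F (idx j) (a j)) ->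
    (forall j, a j <> 0) -> free_fam a.
  move=> idx_inj Fa a0 c e j.
  have acj : a j *~ c j = 0.
    by apply: (uniq m idx (fun j => a j *~ c j)) => // l; exact: sgrpMz.
  apply: contrapT => /eqP cj0; apply: (a0 j).
  by apply: (torsion_freeMz tfR _ cj0 acj); exact: FR (Fa j).
(* Distinct indices give independent elements, so their number is bounded by the rank. A longest
   enumeration [idx] without repetition is onto, with inverse [rho]. *)
have [m [[idx idx_inj] mmax]] : exists m,
    (exists idx : 'I_m -> I, forall j k, idx j = idx k -> j = k) /\
    forall m', (exists idx : 'I_m' -> I, forall j k, idx j = idx k -> j = k) -> (m' <= m)%N.
  apply: (ex_max_nat (n := n)).
    have f0 : 'I_0 -> I by case.
    by exists f0; case.
  move=> m [idx idx_inj].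
  have fa : free_fam (fun j => al (idx j)).
    by apply: (free_sec m idx) => // j; case: (alP (idx j)).
  have [s [sz sP si]] := free_fam_independent fa; rewrite -sz.
  apply: rkR => // x /sP[i ->]; apply: (FR (idx i)); by case: (alP (idx i)).
have /boolp.choice[rho rhoP] i : exists j, idx j = i.
  apply: contrapT => ni; suff : (m.+1 <= m)%N by rewrite ltnn.
  apply: mmax; exists (fun j => if unlift ord0 j is Some l then idx l else i).
  move=> j k; case: (unliftP ord0 j) => [j'|] ->; case: (unliftP ord0 k) => [k'|] ->;
    rewrite ?liftK ?unlift_none //.
  - by move/idx_inj => ->.
  - by move=> e; case: ni; exists j'.
  - by move=> e; case: ni; exists k'.
have {}gen x : R x -> exists2 f : 'I_m -> V, forall j, F (idx j) (f j) & x = \sum_j f j.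
  move=> /gen[l [id [f [Ff ->]]]].
  exists (fun k => \sum_(j < l | rho (id j) == k) f j).
    move=> k; apply: sgrp_sum => // j /eqP <-; by rewrite rhoP.
  by rewrite (partition_big (fun j => rho (id j)) predT).
have pF i : pure_in (F (idx i)) R.
  move=> x N /gen[f Ff ->] N0 Fi; rewrite (bigD1 i) //= big1 ?addr0 // => j ji.
  (* The difference of two decompositions of one element of [F (idx i)]: componentwise, and as a
     single component at [i]. *)
  pose g l := f l *+ N - (if l == i then (\sum_j f j) *+ N else 0).
  have g0 : g j = 0.
    apply: (uniq m idx) => // [l|].
      apply: sgrpB => //; first exact: sgrpMn.
      by case: eqVneq => [->//|_]; exact: sgrp0.
    by rewrite sumrB -big_mkcond big_pred1_eq -sumrMnl subrr.
  apply: (torsion_freeMn tfR _ N0); first exact: FR (Ff j).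
  by move: g0; rewrite /g (negPf ji) subr0.
have [a aP] : exists a : 'I_m -> V, forall i, [/\ F (idx i) (a i), a i <> 0 &
    forall j N, (0 < N)%N -> dvdin R N (a i) -> dvdin R N (a j)].
  case: (EM (exists j0 : 'I_m, True)) => [[j0 _]|nj]; last first.
    by exists (fun=> 0) => i; case: nj; exists i.
  have [Fx x0] := alP (idx j0); set x := al _ in Fx x0.
  have Rx : R x by exact: FR Fx.
  (* Every generator is matched to the same [x], so all of them have the same divisors; purity keeps
     each in its summand. *)
  have /boolp.choice[a aP] i : exists y, [/\ F (idx i) y, y <> 0 &
      forall N, (0 < N)%N -> dvdin R N x <-> dvdin R N y].
    have [Fy y0] := alP (idx i); have Ry := FR _ _ Fy.
    have [y' [Ry' y'0 [c [d [c0 d0 e]]] E]] :=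
      same_type_adjust sR tfR Rx Ry y0 (homR _ _ Rx Ry x0 y0).
    exists y'; split=> //; apply: (pF i _ c) => //; rewrite e; exact: sgrpMn.
  exists a => i; have [Fa a0 Ea] := aP i; split=> // j N N0.
  by have [_ _ Ej] := aP j; rewrite -Ea // -Ej.
apply: (@homogeneous_basis_pure_split _ _ m a) => //.
- by move=> i; have [Fa _ _] := aP i; exact: FR Fa.
- by apply: (free_sec m idx) => // j; case: (aP j).
- by move=> i j N N0; have [_ _ /(_ j N N0)] := aP i.
move=> x /gen[f Ff ->]; exists f => // i; split; first exact: FR (Ff i).
have [Fa a0 _] := aP i; have [_ [_ [_ /(_ _ _ (Ff i) Fa)]]] := F1 (idx i).
move=> [c [d [cd0 e]]].
have c0 : c != 0.
  apply/eqP => c0; rewrite c0 mulr0z in e; apply: a0.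
  case: cd0 => [|d0]; first by rewrite c0.
  by apply: (torsion_freeMz tfR (FR _ _ Fa) d0).
exists `|c|%N; first by rewrite absz_gt0.
rewrite pmulrn abszE; case: (ger0P c) => _; first by exists d.
by exists (- d); rewrite !mulrNz e.
Qed.

End Decomposable.

(** * Types and rank of a reduced group whose pure subgroups split *)

Section Reduced.
Variables (V : zmodType) (R : V -> Prop).
Hypotheses (sR : subgroup R) (tfR : torsion_free_on R) (splitR : pure_split R).
Implicit Types (A B C P : V -> Prop) (x y : V).

Lemma dvdinMz_abs n x (m : int) : dvdin R n (x *~ m) -> dvdin R n (x *+ `|m|%N).
Proof.
rewrite pmulrn abszE; case: (ger0P m) => _ //; rewrite mulrNz => ?.
by apply: (@sgrpN _ (dvdin R n)) => //; exact: sgrp_dvdin.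
Qed.

Lemma dvdinMn n x m : dvdin R n x -> dvdin R n (x *+ m).
Proof. by rewrite pmulrn; exact: dvdinMz. Qed.

(** Write [M = c p^l] with [c] prime to [p]. Then [p^(l+k)] divides [M y]; torsion-freeness cancels
    [p^l], and coprimality removes [c]. *)
Lemma dvd_type_infinite x y M p : (0 < M)%N -> prime p -> R y ->
  (forall n, (0 < n)%N -> dvdin R n x -> dvdin R n (y *+ M)) ->
  (forall k, pdiv_in R p k x) -> forall k, pdiv_in R p k y.
Proof.
move=> M0 pp Ry xy xi k; have [c cp Mc] := pfactor_coprime pp M0.
have p0 j : (0 < p ^ j)%N by rewrite expn_gt0 prime_gt0.
apply: (@dvdin_coprime _ _ sR _ c) => //; first exact: coprimeXl.
apply/(dvdin_pmul2 sR tfR _ (p0 (logn p M))); first exact: sgrpMn.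
rewrite -mulrnA -Mc -expnD; apply: xy; [exact: p0 | exact: xi].
Qed.

Lemma dvd_type_large x y M p k : (0 < M)%N -> prime p -> (M < p)%N -> R y ->
  (forall n, (0 < n)%N -> dvdin R n x -> dvdin R n (y *+ M)) ->
  pdiv_in R p k x -> pdiv_in R p k y.
Proof.
move=> M0 pp Mp Ry xy xk; apply: (@dvdin_coprime _ _ sR _ M) => //.
  by apply: coprimeXl; rewrite prime_coprime // gtnNdvd.
by apply: xy => //; rewrite expn_gt0 prime_gt0.
Qed.

(** The factors [M] and [N] are prime to every larger prime, and at the remaining primes they change
    heights by finite amounts only. *)
Lemma dvd_same_type x y M N : (0 < M)%N -> (0 < N)%N -> R x -> R y ->
  (forall n, (0 < n)%N -> dvdin R n x -> dvdin R n (y *+ M)) ->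
  (forall n, (0 < n)%N -> dvdin R n y -> dvdin R n (x *+ N)) ->
  same_type R x y.
Proof.
move=> M0 N0 Rx Ry xy yx; split=> [p pp|].
  by split; [exact: (dvd_type_infinite M0) | exact: (dvd_type_infinite N0)].
exists (maxn M N).+1 => p pp; rewrite gtn_max => /andP[Mp Np] k.
by split; [exact: (dvd_type_large M0) | exact: (dvd_type_large N0)].
Qed.

Definition pure_line x y := R y /\ pclos (mults x) y.

Lemma sgrp_pure_line x : subgroup (pure_line x).
Proof. by apply: sgrpI => //; exact/sgrp_pclos/sgrp_mults. Qed.

Lemma pure_line_self x : R x -> pure_line x x.
Proof. by move=> Rx; split=> //; exists 1%N => //; exists 1. Qed.

Lemma pure_line_split x : exists B, direct_sum_of R (pure_line x) B.
Proof.
apply: splitR; [exact: sgrp_pure_line | by move=> y [] |].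
move=> y n Ry n0 [_ [N N0 yN]]; split=> //; exists (n * N)%N.
  by rewrite muln_gt0 n0.
by rewrite mulrnA.
Qed.

Lemma pure_lineP x y : pure_line x y -> y <> 0 ->
  exists N m, [/\ (0 < N)%N, m != 0 & y *+ N = x *~ m].
Proof.
move=> [Ry [N N0 [m e]]] y0; exists N, m; split=> //; apply/eqP => m0.
by apply: y0; apply: (torsion_freeMn tfR Ry N0); rewrite e m0 mulr0z.
Qed.

Lemma rank_one_pure_line x : R x -> x <> 0 -> rank_one (pure_line x).
Proof.
move=> Rx x0; split; first exact: sgrp_pure_line.
split; first by move=> y [Ry _]; exact: tfR.
split; first by exists x; split=> //; exact: pure_line_self.
move=> y z xy xz.
have [->|/eqP y0] := eqVneq y 0; first by exists 1, 0; rewrite mul0rz mulr0z; split=> //; left.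
have [->|/eqP z0] := eqVneq z 0; first by exists 0, 1; rewrite mul0rz mulr0z; split=> //; right.
have [N [m [N0 m0 yN]]] := pure_lineP xy y0.
have [N' [m' [N'0 m'0 zN]]] := pure_lineP xz z0.
exists (N%:Z * m'), (N'%:Z * m); split; first by left; rewrite mulf_neq0 // eqz_nat -lt0n.
by rewrite !mulrzA -!pmulrn yN zN mulrzAC.
Qed.

(** For torsion-free [R] this says that [R] is reduced, as the elements divisible by every [n] form
    a divisible subgroup. *)
Hypothesis redR : forall x, R x -> (forall n, (0 < n)%N -> dvdin R n x) -> x = 0.

(* Retract onto the pure line of [w = n a + b], where [n] does not divide [b]: if [b] went to 0,
   then [w] would be [n] times the image of [a], and [n] would divide [b]. *)
Lemma summand_type_le A B a b : direct_sum_of R A B -> A a -> B b -> b <> 0 ->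
  exists2 M, (0 < M)%N & forall k, (0 < k)%N -> dvdin R k b -> dvdin R k (a *+ M).
Proof.
move=> RAB Aa Bb b0.
have Ra := dsum_subl RAB Aa; have Rb := dsum_subr RAB Bb.
have [n n0 nb] : exists2 n, (0 < n)%N & ~ dvdin R n b.
  apply: contrapT => nn; apply: b0; apply: redR => // n n0.
  by apply: contrapT => nb; apply: nn; exists n.
pose w := a *+ n + b.
have Rw : R w by apply: sgrpD => //; exact: sgrpMn.
have [E RwE] := pure_line_split w.
have [f [fC _ fid _ fB]] := dsum_proj RwE.
have fR y : R y -> R (f y) by move=> /fC[].
have fb0 : f b <> 0.
  move=> fb0; apply: nb; exists (f a - a); split; first by apply: sgrpB => //; exact: fR.
  rewrite mulrnBl -(additive_onMn sR fB) //.
  have <- : f w = f (a *+ n).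
    by rewrite (additive_onD sR fB) ?fb0 ?addr0 //; exact: sgrpMn.
  by rewrite fid; [rewrite addrC addKr | exact: pure_line_self].
have [N [m [N0 m0 e]]] := pure_lineP (fC b Rb) fb0.
have [g [gA _ gid g0 gB]] := dsum_proj RAB.
exists (n * `|m|)%N; first by rewrite muln_gt0 n0 absz_gt0.
move=> k k0 [y [Ry yb]]; rewrite mulrnA; apply: dvdinMz_abs.
have <- : g (w *~ m) = a *+ n *~ m.
  rewrite (additive_onMz sR gB) // (additive_onD sR gB) //; last exact: sgrpMn.
  by rewrite (g0 b) // addr0 gid //; apply: sgrpMn => //; case: RAB.
exists (g (f y *+ N)); split.
  by apply: (dsum_subl RAB); apply: gA; apply: sgrpMn => //; exact: fR.
rewrite -(additive_onMn sR gB); last by apply: sgrpMn => //; exact: fR.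
by rewrite -e -yb (additive_onMn sR fB) // mulrnAC.
Qed.

(** Split off the pure line of [x] and write [y = c + b], with [c] on the line. If [b = 0], then [y]
    is a rational multiple of [x]. Otherwise [summand_type_le], used in both directions, compares
    [x] with [b], while [c] is a rational multiple of [x]. *)
Lemma reduced_homogeneous : homogeneous_on R.
Proof.
move=> x y Rx Ry x0 y0; have [B RxB] := pure_line_split x.
have [f [fC fB' _ _ fB]] := dsum_proj RxB.
have [Rc [N N0 [m cN]]] := fC y Ry; have Bb := fB' y Ry.
set c := f y in Rc cN Bb; set b := y - c in Bb.
have Rb := dsum_subr RxB Bb.
have [b0|/eqP b0] := eqVneq b 0.
  have yc : y = c by apply/eqP; rewrite -subr_eq0 -/b b0.
  rewrite -yc in cN.
  have m0 : m != 0.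
    apply/eqP => m0; apply: y0; apply: (torsion_freeMn tfR Ry N0).
    by rewrite cN m0 mulr0z.
  apply: (@dvd_same_type _ _ N `|m|%N) => //; first by rewrite absz_gt0.
    by move=> n _ nx; rewrite cN; exact: dvdinMz.
  by move=> n _ ny; apply: dvdinMz_abs; rewrite -cN; exact: dvdinMn.
have [M1 M10 bx] := summand_type_le RxB (pure_line_self Rx) Bb b0.
have [M2 M20 xb] := summand_type_le (dsumC RxB) Bb (pure_line_self Rx) x0.
apply: (@dvd_same_type _ _ (N * M2) M1) => //; first by rewrite muln_gt0 N0.
  move=> n n0 nx; rewrite -(subrK c y) -/b mulrnDl; apply: dvdinD => //.
    by rewrite mulnC mulrnA; apply: dvdinMn; exact: xb.
  by rewrite mulrnA cN; apply: dvdinMn; exact: dvdinMz.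
move=> n n0 [z [Rz zy]]; apply: bx => //.
exists (z - f z); split; first exact: (dsum_subr RxB (fB' z Rz)).
by rewrite mulrnBl -(additive_onMn sR fB) // zy.
Qed.

(** The recursion exposes the coefficient of the most recently added generator, which
    [reduced_finite_rank] shows to be 0 step by step. *)
Fixpoint lspan (s : seq V) x : Prop :=
  if s is y :: s' then exists k : int, lspan s' (x - y *~ k) else x = 0.

Lemma sgrp_lspan s : subgroup (lspan s).
Proof.
elim: s => [|y s IHs] /=; first by split=> // x y -> ->; rewrite subr0.
split; first by exists 0; rewrite mulr0z subr0; exact: sgrp0.
move=> x z [k xk] [l zl]; exists (k - l).
by rewrite mulrzBr opprD addrACA -opprD; exact: sgrpB.
Qed.

Lemma lspan_cons y s x : lspan s x -> lspan (y :: s) x.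
Proof. by exists 0; rewrite mulr0z subr0. Qed.

Lemma lspan_head y s : lspan (y :: s) y.
Proof. by exists 1; rewrite mulr1z subrr; case: (sgrp_lspan s). Qed.

Lemma lspan_span_on s x : lspan s x -> span_on (fun i : 'I_(size s) => s`_i) predT x.
Proof.
elim: s x => [|y s IHs] x /=.
  by move=> ->; apply: sgrp0; exact: sgrp_span_on.
case=> k /IHs[c _ e].
exists (fun i => if unlift ord0 i is Some j then c j else k) => //.
rewrite big_ord_recl unlift_none /=; under eq_bigr do rewrite liftK.
by rewrite -e addrC subrK.
Qed.

(* With an infinite independent sequence [a], the pure closure [H] of all [a_i - (i+1) a_(i+1)]
   has no complement: in a complement, [a_0] would become divisible by every [n!]. *)
Lemma reduced_finite_rank : finite_rank_on R.
Proof.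
apply: contrapT => nfin.
(* A finite list [s] in [R] on which all of [R] depended would bound the rank by its size. *)
have /boolp.choice[g gP] s : exists y, (forall x, x \in s -> R x) ->
    R y /\ ~ pclos (lspan s) y.
  case: (EM (forall x, x \in s -> R x)) => [Rs|nRs]; last by exists 0.
  apply: contrapT => ny; apply: nfin; exists (size s) => t Rt it.
  apply: (free_fam_leq (s := fun i : 'I_(size s) => s`_i) (t := fun i : 'I_(size t) => t`_i)) => //.
  move=> j; have Rtj : R t`_j by apply: Rt; exact: mem_nth.
  apply: contrapT => nj; apply: ny; exists t`_j => _; split=> // -[N N0 tN].
  by apply: nj; exists N => //; exact: lspan_span_on.
(* [al n] lists the first [n] terms of the sequence, [a (n-1)] first and [a 0] last. *)
pose al := fix al n := if n is n'.+1 then g (al n') :: al n' else [::].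
pose a n := g (al n).
have Ral n x : x \in al n -> R x.
  elim: n x => // n IHn x; rewrite inE => /predU1P[->|/IHn //].
  by have [] := gP (al n) IHn.
have Ra n : R (a n) by have [] := gP (al n) (Ral n).
have na n : ~ pclos (lspan (al n)) (a n) by have [] := gP (al n) (Ral n).
pose d n := a n - a n.+1 *+ n.+1.
have Rd n : R (d n) by apply: sgrpB => //; exact: sgrpMn.
pose gl := fix gl n := if n is n'.+1 then d n' :: gl n' else [::].
have al_mono m n x : (m <= n)%N -> lspan (al m) x -> lspan (al n) x.
  by move/subnKC <-; elim: (n - m)%N => [|l IHl] xm; rewrite ?addn0 // addnS; exact/lspan_cons/IHl.
have gl_mono m n x : (m <= n)%N -> lspan (gl m) x -> lspan (gl n) x.
  by move/subnKC <-; elim: (n - m)%N => [|l IHl] xm; rewrite ?addn0 // addnS; exact/lspan_cons/IHl.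
have d_al n : lspan (al n.+2) (d n).
  apply: (sgrpB (sgrp_lspan (al n.+2))); first exact/lspan_cons/lspan_head.
  by apply: (sgrpMn _ (sgrp_lspan (al n.+2))); exact: lspan_head.
have gl_al n x : lspan (gl n) x -> lspan (al n.+1) x.
  elim: n x => [x ->|n IHn x [k xk]]; first by case: (sgrp_lspan (al 1)).
  rewrite -(subrK (d n *~ k) x); apply: (sgrpD (sgrp_lspan (al n.+2))).
    exact/lspan_cons/IHn.
  exact: (sgrpMz _ (sgrp_lspan (al n.+2))).
pose H x := R x /\ exists n, pclos (lspan (gl n)) x.
have sH : subgroup H.
  split; first by split; [exact: sgrp0 | exists 0%N, 1%N].
  move=> x y [Rx [m [N N0 xN]]] [Ry [n [M M0 yM]]]; split; first exact: sgrpB.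
  exists (maxn m n); apply: (sgrpB (sgrp_pclos (sgrp_lspan (gl (maxn m n))))).
    by exists N => //; apply: gl_mono xN; exact: leq_maxl.
  by exists M => //; apply: gl_mono yM; exact: leq_maxr.
have [||K RHK] := splitR sH.
- by move=> x [].
- move=> x n Rx n0 [_ [m [N N0 xN]]]; split=> //; exists m, (n * N)%N.
    by rewrite muln_gt0 n0.
  by rewrite mulrnA.
have [f [fK fH _ f0 fB]] := dsum_proj (dsumC RHK).
have fR x : R x -> R (f x) by move=> /fK; exact: (dsum_subr RHK).
have fa n : f (a n) = f (a n.+1) *+ n.+1.
  rewrite -(additive_onMn sR fB) //.
  apply/eqP; rewrite -subr_eq0 -fB //; last exact: sgrpMn.
  apply/eqP/f0; split; first exact: Rd.
  by exists n.+1, 1%N => //; rewrite mulr1n; exact: lspan_head.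
have fa0 n : f (a 0%N) = f (a n) *+ n`!.
  by elim: n => [|n IHn]; rewrite ?mulr1n // IHn fa -mulrnA factS.
have fa00 : f (a 0%N) = 0.
  apply: redR; first exact: fR.
  move=> n n0; apply: (@dvdin_dvdn _ _ sR n n`!); first by rewrite dvdn_fact // n0 leqnn.
  by exists (f (a n)); split; [exact: fR | rewrite -fa0].
have [_ [n [N N0 aN]]] : H (a 0%N) by have := fH _ (Ra 0%N); rewrite fa00 subr0.
(* Descent on the number of [d]'s spanning a multiple of [a 0]: a non-zero coefficient of [d n]
   would make [a n.+1] depend on earlier terms. At the end a positive multiple of [a 0] is 0,
   contrary to its choice. *)
elim: n aN => [/= aN|n IHn [k aN]]; first by apply: (na 0%N); exists N.
suff k0 : k = 0 by apply: IHn; rewrite k0 mulr0z subr0 in aN.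
apply: contrapT => /eqP k0.
have sA := sgrp_lspan (al n.+1).
apply: (na n.+1); apply: (pclosMz sA (m := n.+1%:Z * k)); first by rewrite mulf_neq0.
have dk : lspan (al n.+1) (d n *~ k).
  rewrite -[d n *~ k]opprK -[X in - X](addKr (a 0%N *+ N)) opprD opprK.
  apply: (sgrpB sA); last exact: gl_al.
  apply: (sgrpMn _ sA); apply: (@al_mono 1%N) => //; exact: lspan_head.
have -> : a n.+1 *~ (n.+1%:Z * k) = a n *~ k - d n *~ k.
  by rewrite mulrzA -pmulrn -mulrzBl /d opprB addrC subrK.
by apply: (sgrpB sA) => //; apply: (sgrpMz _ sA); exact: lspan_head.
Qed.

End Reduced.

(** * Complete decomposability by splitting off pure lines *)

Section Decomposition.
Variables (V : zmodType) (R : V -> Prop).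
Hypotheses (sR : subgroup R) (tfR : torsion_free_on R) (splitR : pure_split R).
Implicit Types (A B C P : V -> Prop) (x y : V).

Lemma summand_pure C A B : torsion_free_on C -> direct_sum_of C A B -> pure_in B C.
Proof.
move=> tfC CAB x n Cx n0 Bxn.
have [sA [sB [AB /(_ x)[/(_ Cx)[a [b [Aa [Bb xab]]]] _]]]] := CAB.
suff a0 : a = 0 by rewrite xab a0 add0r.
apply: (torsion_freeMn tfC (dsum_subl CAB Aa) n0); apply: AB; first exact: sgrpMn.
by rewrite -(addrK (b *+ n) (a *+ n)) -mulrnDl -xab; apply: sgrpB => //; exact: sgrpMn.
Qed.

Lemma fully_decomposable_zero P : subgroup P -> (forall x, P x -> x = 0) ->
  fully_decomposable_on P.
Proof.
move=> sP P0; split=> //; exists void, (fun _ _ => False); split; first by case.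
split; first by case.
split=> [x /P0 ->|n idx]; last by move=> f _ _ _ j; case: (idx j).
have idx0 : 'I_0 -> void by case.
by exists 0%N, idx0, (fun=> 0); split; [case | rewrite big_ord0].
Qed.

(** The new rank-one summand gets the index [None]. *)
Lemma fully_decomposable_dsum P A B : direct_sum_of P A B -> subgroup P ->
  rank_one A -> fully_decomposable_on B -> fully_decomposable_on P.
Proof.
move=> PAB sP A1 [sB [I [F [F1 [FB [gen uniq]]]]]].
have [sA [_ [AB PABx]]] := PAB.
split=> //; exists (option I), (oapp F A); split; first by case.
split.
  case=> [i|] x /= Fx; last exact: (dsum_subl PAB).
  by apply: (dsum_subr PAB); exact: FB Fx.
split.
  move=> _ /PABx[a [b [Aa [/gen[n [idx [f [Ff ->]]]] ->]]]].
  exists n.+1, (fun i => omap idx (unlift ord0 i)), (ext_fam a f); split.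
    by move=> i; rewrite /ext_fam; case: (unliftP ord0 i) => [j|] _ //=; exact: Ff.
  rewrite big_ord_recl /ext_fam unlift_none; congr (_ + _).
  by apply: eq_bigr => i _; rewrite liftK.
move=> n idx f idx_inj Ff.
have some_idx m (h : 'I_m -> 'I_n) : (forall i, idx (h i) <> None) ->
    exists idx' : 'I_m -> I, forall i, idx (h i) = Some (idx' i).
  move=> hN; have /boolp.choice[k kP] i : exists j, idx (h i) = Some j.
    by case E : (idx (h i)) => [j|]; [exists j | case: (hN i)].
  by exists k.
(* At most one term has index [None]. It is minus a sum in [B], hence 0, and the relation that
   remains is one in [B]. *)
case: (EM (exists j, idx j = None)) => [[j0 Ej0]|nN] e; last first.
  have [|idx' E] := some_idx n id; first by move=> i Ei; apply: nN; exists i.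
  apply: (uniq n idx') => // [j k Ejk|j]; last by have := Ff j; rewrite [idx j]E.
  by apply: idx_inj; rewrite [idx j]E [idx k]E Ejk.
have [|idx' E] := some_idx n.-1 (lift j0).
  move=> i Ei; have : lift j0 i = j0 by apply: idx_inj; rewrite Ei Ej0.
  by move/eqP; rewrite eq_sym (negPf (neq_lift _ _)).
have Ff' i : F (idx' i) (f (lift j0 i)) by have := Ff (lift j0 i); rewrite E.
have Aj0 : A (f j0) by have := Ff j0; rewrite Ej0.
rewrite (bigD1_ord j0) //= in e.
have Bs : B (\sum_(i < n.-1) f (lift j0 i)).
  by apply: sgrp_sum => // i _; exact: FB (Ff' i).
have fj0 : f j0 = 0.
  apply: AB => //; move/eqP: e; rewrite addr_eq0 => /eqP ->; exact: sgrpN.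
rewrite fj0 add0r in e => j.
case: (unliftP j0 j) => [i|] -> //.
apply: (uniq n.-1 idx' (fun i => f (lift j0 i))) => // k l Ekl.
by apply: (@lift_inj _ j0); apply: idx_inj; rewrite !E Ekl.
Qed.

(** Induction on the rank bound: the pure line of some [x] in [P] splits off with complement in [B],
    and prepending [x] to an independent list of that complement keeps it independent, so the bound
    drops. *)
Lemma pure_fully_decomposable n P : subgroup P -> (forall x, P x -> R x) ->
  pure_in P R ->
  (forall s : seq V, (forall x, x \in s -> P x) -> independent s -> (size s <= n)%N) ->
  fully_decomposable_on P.
Proof.
elim: n P => [|n IHn] P sP PR pP rkP.
  apply: fully_decomposable_zero => // x Px; apply: contrapT => x0.
  suff : (size [:: x] <= 0)%N by [].
  apply: rkP => [y|c]; first by rewrite inE => /eqP ->.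
  rewrite big_ord1 /= => e i; rewrite ord1; apply: contrapT => /eqP c0; apply: x0.
  exact: (torsion_freeMz tfR (PR x Px) c0 e).
case: (EM (exists2 x, P x & x <> 0)) => [[x Px x0]|nx]; last first.
  by apply: fully_decomposable_zero => // x Px; apply: contrapT => x0; apply: nx; exists x.
have Rx := PR x Px.
have [B RCB] := pure_line_split sR splitR x.
have [sC [sB [CB RCBx]]] := RCB.
have CP y : pure_line R x y -> P y.
  by case=> Ry [N N0 [m e]]; apply: (pP _ N) => //; rewrite e; exact: sgrpMz.
have sPB : subgroup (fun y => P y /\ B y) by exact: sgrpI.
have PCB : direct_sum_of P (pure_line R x) (fun y => P y /\ B y).
  apply: dsumI => //.
  - by move=> y [].
  - by move=> y Cy [_ By]; exact: CB.
  - move=> y Py; have /RCBx[c [b [Cc [Bb e]]]] := PR y Py.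
    exists c => //; split; first by apply: sgrpB => //; exact: CP.
    by rewrite e addrC addKr.
apply: (fully_decomposable_dsum PCB sP); first exact: rank_one_pure_line.
apply: IHn => //.
- by move=> y [/PR].
- move=> y k Ry k0 [Pyk Byk]; split; first exact: pP Pyk.
  exact: (summand_pure tfR RCB) Byk.
move=> s sP' si; rewrite -ltnS; apply: (rkP (x :: s)).
  by move=> y; rewrite inE => /predU1P[->//|/sP'[]].
move=> c; rewrite big_ord_recl /= => e.
have Bs : B (\sum_(i < size s) s`_i *~ c (lift ord0 i)).
  apply: sgrp_sum => // i _; apply: sgrpMz => //.
  by have [] := sP' s`_i (mem_nth _ (ltn_ord i)).
have xc : x *~ c ord0 = 0.
  apply: CB; first by apply: sgrpMz => //; exact: pure_line_self.
  by move/eqP: e; rewrite addr_eq0 => /eqP ->; exact: sgrpN.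
rewrite xc add0r in e.
have c0 : c ord0 = 0.
  by apply: contrapT => /eqP c0; apply: x0; exact: (torsion_freeMz tfR Rx c0 xc).
move=> i; case: (unliftP ord0 i) => [j|] -> //.
exact: (si (fun j => c (lift ord0 j)) e).
Qed.

Lemma pure_split_fully_decomposable : finite_rank_on R -> fully_decomposable_on R.
Proof. by case=> n; exact: pure_fully_decomposable. Qed.

End Decomposition.

(** * Consequences of the extending property *)

Section Extending.
Variable V : zmodType.
Hypothesis extV : forall H : V -> Prop, subgroup H ->
  exists A, direct_summand A /\ essential_in H A.
Implicit Types (A B C F P : V -> Prop) (x y z : V).

Local Notation T := (@is_torsion V).

Lemma sgrp_torsion : subgroup T.
Proof.
split; first by exists 1%N; rewrite mulr1n.
move=> x y [n [n0 xn]] [m [m0 ym]]; exists (n * m)%N; split; first by rewrite muln_gt0 n0.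
by rewrite mulrnBl mulrnA xn mul0rn mulnC mulrnA ym mul0rn subr0.
Qed.

Lemma is_torsion_mul x n : (0 < n)%N -> is_torsion (x *+ n) -> is_torsion x.
Proof.
move=> n0 [m [m0 e]]; exists (n * m)%N; rewrite muln_gt0 n0 m0; split=> //.
by rewrite mulrnA.
Qed.

Lemma is_torsion_mulz x m : m != 0 -> is_torsion (x *~ m) -> is_torsion x.
Proof.
move=> m0 [n [n0 e]]; apply: (@is_torsionMz _ _ (m * n%:Z)); last by rewrite mulrzA.
by rewrite mulf_neq0 // eqz_nat -lt0n.
Qed.

(** A summand in which the torsion subgroup is essential is torsion, since each of its non-zero
    elements has a non-zero torsion multiple. *)
Lemma torsion_summand : exists F, direct_sum_of (fun _ => True) T F.
Proof.
have [A [[F VAF] TA]] := extV sgrp_torsion.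
suff <- : A = T by exists F.
have [sA _] := VAF.
apply: boolp.funext => x; apply: boolp.propext; split; last by case: TA => _ [+ _]; exact.
move=> Ax; have [->|/eqP x0] := eqVneq x 0; first by case: sgrp_torsion.
have [k Txk xk0] := essentialE sA TA Ax x0.
by apply: is_torsion_mulz Txk; apply/eqP => k0; apply: xk0; rewrite k0 mulr0z.
Qed.

(* A summand in which [n z + t] generates an essential subgroup is torsion-free, so the projection
   kills [t] and sends [n z + t] to itself; hence [n z + t] is divisible by [n]. *)
Lemma torsion_divisible z : ~ is_torsion z -> divisible_on T.
Proof.
move=> nz; split; first exact: sgrp_torsion.
move=> t n Tt n0; pose w := z *+ n + t.
have [A [[B VAB] HA]] := extV (sgrp_mults w).
have [sA _] := VAB.
have nw : ~ is_torsion w.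
  move=> Tw; apply: nz; apply: (is_torsion_mul n0).
  by rewrite -(addrK t (z *+ n)); apply: sgrpB => //; exact: sgrp_torsion.
have Aw : A w by case: HA => _ [HA _]; apply: HA; exists 1.
have [f [fA _ fid _ fB]] := dsum_proj VAB.
have sT := sgrp_torsion.
have ft : f t = 0.
  apply: contrapT => ft0; have [k [m e] fk0] := essentialE sA HA (fA t I) ft0.
  apply: nw; apply: (@is_torsion_mulz _ m).
    by apply/eqP => m0; apply: fk0; rewrite e m0 mulr0z.
  rewrite -e; apply: sgrpMz => //; have [l [l0 tl]] := Tt; exists l; split=> //.
  by rewrite -(additive_onMn (@sgrpT V) fB) // tl; exact: (additive_on0 (@sgrpT V) fB).
have e : (f z - z) *+ n = t.
  have := fid w Aw; rewrite {1}/w (additive_onD (@sgrpT V) fB) // ft addr0.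
  by rewrite (additive_onMn (@sgrpT V) fB) // mulrnBl => ->; rewrite addrC addKr.
by exists (f z - z); split=> //; apply: (is_torsion_mul n0); rewrite e.
Qed.

(** The modular law. *)
Lemma dsum_restrict C P B : direct_sum_of (fun _ => True) P B -> subgroup C ->
  (forall x, P x -> C x) -> direct_sum_of C P (fun x => B x /\ C x).
Proof.
move=> [sP [sB [PB VPB]]] sC PC; apply: dsumI => //.
- exact: sgrpI.
- by move=> x [].
- by move=> x Px [Bx _]; exact: PB.
- move=> x Cx; have [/(_ I)[p [b [Pp [Bb e]]]] _] := VPB x; exists p => //.
  by split; [rewrite e addrC addKr | apply: sgrpB => //; exact: PC].
Qed.

(** A summand [A] in which [P] is essential is torsion-free, because [P] is. For [x = t + y] in [A]
    with [N x] in [P], [N t] is 0, so purity puts [y] in [P]. Then [t] is a torsion element of [A],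
    hence 0, and [A = P]. *)
Lemma pure_torsion_free_summand F P : direct_sum_of (fun _ => True) T F ->
  subgroup P -> (forall x, P x -> F x) -> pure_in P F ->
  exists B, direct_sum_of (fun _ => True) P B.
Proof.
move=> VTF sP PF pP; have [A [[B VAB] HA]] := extV sP.
have [sT [sF [TF VTFx]]] := VTF; have [sA _] := VAB.
suff <- : A = P by exists B.
have AT x : A x -> is_torsion x -> x = 0.
  move=> Ax Tx; apply: contrapT => x0; have [k Pk k0] := essentialE sA HA Ax x0.
  by apply: k0; apply: TF; [exact: sgrpMz | exact: PF].
apply: boolp.funext => x; apply: boolp.propext; split; last by case: HA => _ [+ _]; exact.
move=> Ax; have [->|/eqP x0] := eqVneq x 0; first exact: sgrp0.
have [k Pk k0] := essentialE sA HA Ax x0.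
have [N N0 PN] : pclos P x.
  by apply: (pclosMz sP _ Pk); apply/eqP => kz; apply: k0; rewrite kz mulr0z.
have [/(_ I)[t [y [Tt [Fy e]]]] _] := VTFx x.
have tN : t *+ N = 0.
  apply: TF; first exact: sgrpMn.
  rewrite -(addrK (y *+ N) (t *+ N)) -mulrnDl -e; apply: sgrpB => //; first exact: PF.
  exact: sgrpMn.
have Py : P y by apply: (pP y N) => //; rewrite -(add0r (y *+ N)) -tN -mulrnDl -e.
suff t0 : t = 0 by rewrite e t0 add0r.
apply: AT => //; rewrite -(addrK y t) -e; apply: sgrpB => //.
by case: HA => _ [+ _]; exact.
Qed.

End Extending.

(** * The divisible part and the structure of the group *)

Section Structure.
Variable V : zmodType.
Implicit Types (D F R P : V -> Prop) (x y : V).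

Definition divisible_part F x := F x /\ forall n, (0 < n)%N -> dvdin F n x.

Lemma sgrp_divisible_part F : subgroup F -> subgroup (divisible_part F).
Proof.
move=> sF; apply: sgrpI => //; split.
  by move=> n _; exists 0; rewrite mul0rn; split=> //; exact: sgrp0.
by move=> x y xd yd n n0; apply: dvdinB => //; [exact: xd | exact: yd].
Qed.

Lemma divisible_part_cancel F x n : subgroup F -> torsion_free_on F -> F x ->
  (0 < n)%N -> divisible_part F (x *+ n) -> divisible_part F x.
Proof.
move=> sF tfF Fx n0 [_ xd]; split=> // m m0.
by apply/(dvdin_pmul2 sF tfF m n0 Fx); apply: xd; rewrite muln_gt0 n0.
Qed.

Lemma divisible_part_divisible F : subgroup F -> torsion_free_on F ->
  divisible_on (divisible_part F).
Proof.
move=> sF tfF; split; first exact: sgrp_divisible_part.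
move=> x n Dx n0; have [_ /(_ n n0)[y [Fy e]]] := Dx; exists y; split=> //.
by apply: (divisible_part_cancel sF tfF Fy n0); rewrite e.
Qed.

Lemma extending_structure :
  mixed_group V \/ torsion_free_group V ->
  (forall H : V -> Prop, subgroup H -> exists A, direct_summand A /\ essential_in H A) ->
  exists D R : V -> Prop,
      direct_sum_of (fun _ => True) D R /\
      divisible_on D /\
      (exists D0 : V -> Prop, torsion_free_on D0 /\
         direct_sum_of D (torsion_part D) D0) /\
      torsion_free_on R /\ fully_decomposable_on R /\
      homogeneous_on R /\ finite_rank_on R.
Proof.
move=> mtV extV; have [F VTF] := torsion_summand extV.
have [sT [sF [TF VTFx]]] := VTF.
have tfF : torsion_free_on F by move=> x Fx Tx; exact: TF.
(* A mixed group supplies the element of infinite order that [torsion_divisible] needs; in the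
   torsion-free case the torsion subgroup is 0. *)
have Tdiv : divisible_on (@is_torsion V).
  case: mtV => [[_ [z nz]]|tfV]; first exact: (torsion_divisible extV nz).
  split=> // x n Tx n0; exists 0; rewrite mul0rn (tfV x) //.
  by split=> //; exact: sgrp0.
set D0 := divisible_part F.
have sD0 : subgroup D0 by exact: sgrp_divisible_part.
have D0div : divisible_on D0 by exact: divisible_part_divisible.
have D0F x : D0 x -> F x by case.
have [B VD0B] : exists B, direct_sum_of (fun _ => True) D0 B.
  apply: (pure_torsion_free_summand extV VTF) => // x n Fx n0.
  exact: divisible_part_cancel.
have := dsum_restrict VD0B sF D0F; set R := (fun x => B x /\ F x) => FD0R.
have [_ [sR [D0R FD0Rx]]] := FD0R.
have RF x : R x -> F x by case.
have tfR : torsion_free_on R by move=> x /RF; exact: tfF.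
(* Purity is transitive, so a pure subgroup of [R] is pure in [F], hence a summand of [V], and the
   modular law cuts its complement down to [R]. *)
have splitR : pure_split R.
  move=> P sP PR pP.
  have [||C VPC] := pure_torsion_free_summand extV VTF sP.
  - by move=> x /PR/RF.
  - move=> x n Fx n0 Pxn; apply: (pP x n) => //.
    by apply: (summand_pure tfF FD0R Fx n0); exact: PR.
  by have := dsum_restrict VPC sR PR; exists (fun x => C x /\ R x).
(* An element of [R] divisible by every [n] lies in [D0], which meets [R] trivially. *)
have redR x : R x -> (forall n, (0 < n)%N -> dvdin R n x) -> x = 0.
  move=> Rx xd; apply: D0R => //; split; first exact: RF.
  by move=> n /xd[y [Ry e]]; exists y; split=> //; exact: RF.
have fin := reduced_finite_rank sR splitR redR.
have sD := sgrp_sumsg sT sD0.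
exists (sumsg (@is_torsion V) D0), R; split.
  apply: dsumI => //.
    move=> _ [t [d [Tt [Dd ->]]]] Rtd; have t0 : t = 0.
      apply: TF => //; rewrite -(addrK d t).
      by apply: sgrpB => //; [exact: RF | exact: D0F].
    by move: Rtd; rewrite t0 add0r; exact: D0R.
  move=> x _; have [/(_ I)[t [y [Tt [Fy ->]]]] _] := VTFx x.
  have /FD0Rx[d [r [Dd [Rr ->]]]] := Fy.
  by exists (t + d); [exists t, d | rewrite [t + (d + r)]addrA [_ - _]addrC addKr].
split.
  split=> // x n [t [d [Tt [Dd ->]]]] n0.
  have [_ /(_ t n Tt n0)[t' [Tt' <-]]] := Tdiv.
  have [_ /(_ d n Dd n0)[d' [Dd' <-]]] := D0div.
  by exists (t' + d'); rewrite mulrnDl; split=> //; exists t', d'.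
split.
  exists D0; split; first by move=> x /D0F; exact: tfF.
  apply: dsumI => //.
  - exact: sgrpI.
  - by move=> x [].
  - by move=> x; exact: sumsgr.
  - by move=> x [_ Tx] /D0F Fx; exact: TF.
  - move=> _ [t [d [Tt [Dd ->]]]]; exists t; last by rewrite addrC addKr.
    by split=> //; exact: sumsgl.
split=> //; split; first exact: pure_split_fully_decomposable.
by split=> //; exact: reduced_homogeneous.
Qed.

End Structure.

(** * The extending property and the structure of the group are equivalent *)

Theorem theorem2p17 (V : zmodType) :
  (mixed_group V \/ torsion_free_group V) ->
  ((forall H : V -> Prop, subgroup H ->
      exists A, direct_summand A /\ essential_in H A)
   <->
   (exists D R : V -> Prop,
      direct_sum_of (fun _ => True) D R /\
      divisible_on D /\
      (exists D0 : V -> Prop, torsion_free_on D0 /\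
         direct_sum_of D (torsion_part D) D0) /\
      torsion_free_on R /\ fully_decomposable_on R /\
      homogeneous_on R /\ finite_rank_on R))
  /\
  ((exists D R : V -> Prop,
      direct_sum_of (fun _ => True) D R /\
      divisible_on D /\
      (exists D0 : V -> Prop, torsion_free_on D0 /\
         direct_sum_of D (torsion_part D) D0) /\
      torsion_free_on R /\ fully_decomposable_on R /\
      homogeneous_on R /\ finite_rank_on R) ->
   semi_generalized_Bassian V).
Proof.
have ext : (exists D R : V -> Prop,
      direct_sum_of (fun _ => True) D R /\
      divisible_on D /\
      (exists D0 : V -> Prop, torsion_free_on D0 /\
         direct_sum_of D (torsion_part D) D0) /\
      torsion_free_on R /\ fully_decomposable_on R /\
      homogeneous_on R /\ finite_rank_on R) ->
    forall H : V -> Prop, subgroup H -> exists A, direct_summand A /\ essential_in H A.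
  move=> [D [R [VDR [Ddiv [_ [tfR [decR [homR finR]]]]]]]].
  apply: (divisible_split_extending VDR Ddiv tfR).
  exact: homogeneous_decomposable_pure_split.
move=> mtV; split; last by move=> /ext extV H sH _; exact: extV.
by split; [exact: extending_structure | exact: ext].
Qed.
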